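(* Consider a locally o-minimal expansion of the ordered group of reals $(\mathbb R,<,0,+)$. Let $\{A_\lambda\}_{\lambda\in\Lambda}$ be a finite family of definable subsets of $\mathbb R^{m+n}$. There exist an open box $B$ in $\mathbb R^n$ containing the origin and a finite partition into definable sets $\mathbb R^m\times B=X_1\cup\cdots\cup X_k$ such that for every $b\in\mathbb R^m$, $B=(X_1)_b\cup\cdots\cup(X_k)_b$ is a definable cell decomposition of $B$, and $X_i\cap A_\lambda=\emptyset$ or $X_i\subset A_\lambda$ for all $1\le i\le k$ and $\lambda\in\Lambda$. Furthermore, for each $i$, the type of the cell $(X_i)_b$ is the same for all $b\in\mathbb R^m$ with $(X_i)_b\neq\emptyset$.
   Context: ''Definable'' means definable with parameters; locally o-minimal means that for every definable $X\subset\mathbb R$ and every $a\in\mathbb R$ there is an open interval $I\ni a$ with $X\cap I$ a finite union of points and open intervals. An open box is a product of open intervals. For $S\subset\mathbb R^{m+n}$ and $b\in\mathbb R^m$, $S_b=\{y\in\mathbb R^n:(b,y)\in S\}$. Definable cells are as in o-minimality: in $\mathbb R$ points and open intervals; in $\mathbb R^n$ graphs of definable continuous functions on a cell in $\mathbb R^{n-1}$ or bands $\{(x,y): f(x)<y<g(x)\}$ between definable continuous $f<g$ (possibly $\pm\infty$) on a cell. A definable cell decomposition of an open box $B\subset\mathbb R^n$ is a partition of $B$ into finitely many definable cells whose projections forgetting the last coordinate form (when $n>1$) a definable cell decomposition of the projected box. For an increasing sequence $1\le j_1<\cdots<j_d\le n$, let $\pi_{(j_1,\ldots,j_d)}(x_1,\ldots,x_n)=(x_{j_1},\ldots,x_{j_d})$;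 a cell $C\subset\mathbb R^n$ of dimension $d$ is of type $(j_1,\ldots,j_d)$ if the restriction of $\pi_{(j_1,\ldots,j_d)}$ to $C$ is a definable homeomorphism onto its image. *)

(* Defs.v *)
From HB Require Import structures.
From mathcomp Require Import all_boot all_order all_algebra.
From mathcomp Require Import all_classical all_reals all_analysis.

Set Implicit Arguments.
Unset Strict Implicit.
Unset Printing Implicit Defensive.

Import Order.TTheory GRing.Theory Num.Theory.
Import numFieldNormedType.Exports.

Local Open Scope classical_set_scope.
Local Open Scope ring_scope.

(* An expansion of the ordered group (R, <, 0, +): the symbols [<], [0], [+]
   are built into the terms and formulas below with their usual meaning, and
   this record gives the additional function and relation symbols together
   with arbitrary interpretations. *)
Record expansion (R : realType) := Expansion {
  fsym : Type;
  farity : fsym -> nat;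
  rsym : Type;
  rarity : rsym -> nat;
  finterp : forall f : fsym, 'rV[R]_(farity f) -> R;
  rinterp : forall r : rsym, set 'rV[R]_(rarity r) }.

Section FirstOrder.
Context {R : realType} (M : expansion R).

Inductive term :=
| Var of nat
| Zero
| Add of term & term
| App (f : fsym M) of ('I_(farity f) -> term).

(* Variables are de Bruijn indices: [Ex] binds variable 0 of its body. *)
Inductive formula :=
| Eq of term & term
| Lt of term & term
| Rel (r : rsym M) of ('I_(rarity r) -> term)
| Not of formula
| And of formula & formula
| Ex of formula.

Fixpoint eval (e : nat -> R) (t : term) : R :=
  match t with
  | Var i => e i
  | Zero => 0
  | Add t1 t2 => eval e t1 + eval e t2
  | App f ts => finterp (\row_i eval e (ts i))
  end.

Definition scons (a : R) (e : nat -> R) (i : nat) : R :=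
  if i is i'.+1 then e i' else a.

Fixpoint holds (e : nat -> R) (phi : formula) : Prop :=
  match phi with
  | Eq t1 t2 => eval e t1 = eval e t2
  | Lt t1 t2 => eval e t1 < eval e t2
  | Rel r ts => @rinterp R M r (\row_i eval e (ts i))
  | Not p => ~ holds e p
  | And p q => holds e p /\ holds e q
  | Ex p => exists a : R, holds (scons a e) p
  end.

Definition env n (x : 'rV[R]_n) (c : nat -> R) (i : nat) : R :=
  if insub i is Some j then x 0 j else c (i - n)%N.

(* The values [c] of the variables of index at least [n] are the parameters;
   a formula uses only finitely many of them. *)
Definition definable n (S : set 'rV[R]_n) : Prop :=
  exists (phi : formula) (c : nat -> R),
    S = [set x | holds (env x c) phi].

End FirstOrder.

Section Cells.
Context {R : realType}.

Definition open_interval (I : set R) : Prop :=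
  exists a b : \bar R, (a < b)%E /\ I = [set x : R | (a < x%:E < b)%E].

Definition open_box n (B : set 'rV[R]_n) : Prop :=
  exists I : 'I_n -> set R,
    (forall i, open_interval (I i)) /\ B = [set x | forall i, I i (x 0 i)].

Definition fiber m n (S : set 'rV[R]_(m + n)) (b : 'rV[R]_m) : set 'rV[R]_n :=
  [set y | S (row_mx b y)].

Definition front n (x : 'rV[R]_n.+1) : 'rV[R]_n := col' ord_max x.

Definition graph n (C : set 'rV[R]_n) (f : 'rV[R]_n -> R) : set 'rV[R]_n.+1 :=
  [set x | C (front x) /\ x 0 ord_max = f (front x)].

Definition band n (C : set 'rV[R]_n) (f g : 'rV[R]_n -> \bar R) :
    set 'rV[R]_n.+1 :=
  [set x | C (front x) /\
           (f (front x) < (x 0 ord_max)%:E < g (front x))%E].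

Variable M : expansion R.

Definition locally_o_minimal : Prop :=
  forall S : set R, definable M [set v : 'rV[R]_1 | S (v 0 0)] ->
  forall a : R, exists I : set R,
    [/\ open_interval I, I a &
      exists (k : nat) (P : 'I_k -> set R),
        (forall i, open_interval (P i) \/ exists c, P i = [set c]) /\
        S `&` I = \bigcup_i P i].

Definition definable_continuous n (C : set 'rV[R]_n) (f : 'rV[R]_n -> R) :
    Prop :=
  definable M (graph C f) /\ {within C, continuous f}.

Definition band_bound n (C : set 'rV[R]_n) (f : 'rV[R]_n -> \bar R) : Prop :=
  [\/ forall x, C x -> f x = -oo%E,
      forall x, C x -> f x = +oo%E |
      exists2 h : 'rV[R]_n -> R, definable_continuous C h &
        forall x, C x -> f x = (h x)%:E].

(* [cell d C]: [C] is a definable cell of dimension [d] in [R^n]; there is none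
   for n = 0, so the base of a graph or band lives in dimension at least 1. *)
Inductive cell : forall n : nat, nat -> set 'rV[R]_n -> Prop :=
| cell_point (a : R) : cell 0 [set x : 'rV[R]_1 | x 0 0 = a]
| cell_interval (I : set R) :
    open_interval I -> cell 1 [set x : 'rV[R]_1 | I (x 0 0)]
| cell_graph n d (C : set 'rV[R]_n) (f : 'rV[R]_n -> R) :
    cell d C -> definable_continuous C f -> cell d (graph C f)
| cell_band n d (C : set 'rV[R]_n) (f g : 'rV[R]_n -> \bar R) :
    cell d C -> band_bound C f -> band_bound C g ->
    (forall x, C x -> (f x < g x)%E) ->
    cell d.+1 (band C f g).

Definition cell_partition n (B : set 'rV[R]_n) (D : set (set 'rV[R]_n)) :
    Prop :=
  [/\ finite_set D, partition D id B & forall C, D C -> exists d, cell d C].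

(* The decomposition is the set [D] of its cells. *)
Inductive cell_decomposition :
    forall n : nat, set 'rV[R]_n -> set (set 'rV[R]_n) -> Prop :=
| cell_decomposition1 (B : set 'rV[R]_1) (D : set (set 'rV[R]_1)) :
    cell_partition B D -> cell_decomposition B D
| cell_decompositionS n (B : set 'rV[R]_n.+1) (D : set (set 'rV[R]_n.+1)) :
    cell_partition B D ->
    cell_decomposition (@front n @` B) [set @front n @` C | C in D] ->
    cell_decomposition B D.

Definition coord_proj n d (J : d.-tuple 'I_n) (x : 'rV[R]_n) : 'rV[R]_d :=
  \row_k x 0 (tnth J k).

(* [f] restricted to [C] is a definable homeomorphism onto its image. *)
Definition definable_homeo n p (C : set 'rV[R]_n) (f : 'rV[R]_n -> 'rV[R]_p) :
    Prop :=
  [/\ definable M [set row_mx x (f x) | x in C],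
      {within C, continuous f} &
      exists2 g : 'rV[R]_p -> 'rV[R]_n,
        forall x, C x -> g (f x) = x & {within f @` C, continuous g}].

(* A cell may be of several types. *)
Definition of_type n d (C : set 'rV[R]_n) (J : d.-tuple 'I_n) : Prop :=
  [/\ cell d C, sorted (fun i j : 'I_n => (i < j)%N) J &
      definable_homeo C (coord_proj J)].

End Cells.

(* Main.v *)
Require Import Defs.
From mathcomp Require Import all_boot all_order all_algebra.
From mathcomp Require Import all_classical all_reals all_analysis.
From mathcomp Require Import lra.

Import Order.TTheory GRing.Theory Num.Theory.
Import numFieldNormedType.Exports.
Local Open Scope classical_set_scope.
Local Open Scope ring_scope.

(** A definable subset of the line without interior meets every compact interval
    in a finite set, hence is countable.  As intervals are uncountable, if
    countably many definable sets cover a box of R^n, one of them has interior;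
    therefore definable functions are continuous somewhere in every box.

    Uniform finiteness of a definable family of finite sets A_e in (-1, 1), with
    e in R^m unbounded, is proved by induction on m.  An extra parameter t in
    [-1, 1] is absorbed by the induction hypothesis: |A_(t,e)| is constant in t
    off a finite set Bad_e, hence is controlled by the union of the A_(s,e), s
    in a finite set definable from e.  For an extra parameter t in R, let P_(y,e)
    be the union of the A_(t,e) that contain y.  If P_(y,e) is infinite, then
    {t : y in A_(t,e)} is uncountable, hence contains a rational; so the set F_e
    of these y is finite.  Either A_(t,e) lies in F_e, or A_(t,e) lies in P_(y,e)
    for some y outside F_e, and F_e and P_(y,e) are families already treated
    (y is a bounded parameter).

    The cell decomposition then follows the o-minimal pattern, fiberwise over
    the parameters: the boundary points of the fibers in the last variable are
    finitely many definable functions of the other variables, and a definable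
    function is piecewise continuous because its discontinuities lie in
    non-open cells, where one variable is determined by the other ones and can
    be dropped. *)

Section Definability.
Set Implicit Arguments.
Unset Strict Implicit.
Context {R : realType} (M : expansion R).
Implicit Types (e u : nat -> R) (A P C : (nat -> R) -> Prop) (f g : (nat -> R) -> R).
Local Notation eval := Defs.eval.

(** * Renaming of variables and closure properties of definable predicates on environments *)

Fixpoint tren (f : nat -> nat) (t : term M) : term M :=
  match t with
  | Var i => Var M (f i)
  | Zero => Zero M
  | Add t1 t2 => Add (tren f t1) (tren f t2)
  | App g ts => App (fun i => tren f (ts i))
  end.

Definition up (f : nat -> nat) (i : nat) : nat :=
  if i is i'.+1 then (f i').+1 else 0%N.

Fixpoint fren (f : nat -> nat) (phi : formula M) : formula M :=
  match phi with
  | Eq t1 t2 => Eq (tren f t1) (tren f t2)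
  | Lt t1 t2 => Lt (tren f t1) (tren f t2)
  | Rel r ts => Rel (fun i => tren f (ts i))
  | Not p => Not (fren f p)
  | And p q => And (fren f p) (fren f q)
  | Ex p => Ex (fren (up f) p)
  end.

Lemma eval_tren (f : nat -> nat) e t : eval e (tren f t) = eval (fun i => e (f i)) t.
Proof.
elim: t => [//|//|t1 IH1 t2 IH2|g ts IH] /=; first by rewrite IH1 IH2.
by congr finterp; apply/rowP => i; rewrite !mxE IH.
Qed.

Lemma holds_fren (f : nat -> nat) e (phi : formula M) :
  holds e (fren f phi) <-> holds (fun i => e (f i)) phi.
Proof.
elim: phi f e => [t1 t2|t1 t2|r ts|p IH|p IHp q IHq|p IH] f e /=.
- by rewrite !eval_tren.
- by rewrite !eval_tren.
- have -> // : (\row_i eval e (tren f (ts i))) =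
    (\row_i eval (fun i => e (f i)) (ts i)).
  by apply/rowP => i; rewrite !mxE eval_tren.
- by rewrite IH.
- by rewrite IHp IHq.
- have E a : (fun i => scons a e (up f i)) = scons a (fun i => e (f i)).
    by apply: funext => -[].
  by split=> -[a h]; exists a; move: h; rewrite IH E.
Qed.

Lemma eval_finite_support (t : term M) :
  exists N, forall e e', (forall i, (i < N)%N -> e i = e' i) ->
    eval e t = eval e' t.
Proof.
elim: t => [i||t1 [N1 IH1] t2 [N2 IH2]|g ts IH] /=.
- by exists i.+1 => e e' ee'; apply: ee'.
- by exists 0%N.
- exists (maxn N1 N2) => e e' ee'.
  by rewrite (IH1 e e') ?(IH2 e e') // => i iN; apply: ee';
    rewrite leq_max iN ?orbT.
- have [N NP] := choice IH.
  exists (\max_i N i) => e e' ee'; congr finterp; apply/rowP => i.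
  rewrite !mxE; apply: NP => j jN; apply: ee'.
  exact: leq_trans jN (leq_bigmax i).
Qed.

(** A formula mentions finitely many variables. Through [dep_Def] this yields the number of
    parameters on which the induction for uniform finiteness runs. *)
Lemma holds_finite_support (phi : formula M) :
  exists N, forall e e', (forall i, (i < N)%N -> e i = e' i) ->
    holds e phi -> holds e' phi.
Proof.
have two (t1 t2 : term M) : exists N, forall e e', (forall i, (i < N)%N -> e i = e' i) ->
    eval e t1 = eval e' t1 /\ @eval R M e t2 = eval e' t2.
  have [N1 H1] := eval_finite_support t1; have [N2 H2] := eval_finite_support t2.
  exists (maxn N1 N2) => e e' ee'.
  by split; [apply: H1|apply: H2] => i iN; apply: ee'; rewrite leq_max iN ?orbT.
elim: phi => [t1 t2|t1 t2|r ts|p [N IH]|p [N1 IH1] q [N2 IH2]|p [N IH]] /=.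
- by have [N NP] := two t1 t2; exists N => e e' /NP[-> ->].
- by have [N NP] := two t1 t2; exists N => e e' /NP[-> ->].
- have [N NP] := choice (fun i => eval_finite_support (ts i)).
  exists (\max_i N i) => e e' ee'.
  have -> // : (\row_i eval e (ts i)) = (\row_i eval e' (ts i)).
  apply/rowP => i; rewrite !mxE; apply: NP => j jN; apply: ee'.
  exact: leq_trans jN (leq_bigmax i).
- exists N => e e' ee' np p'; apply: np; apply: IH p' => i iN.
  by rewrite ee'.
- exists (maxn N1 N2) => e e' ee' [hp hq].
  by split; [apply: IH1 hp|apply: IH2 hq] => i iN; apply: ee';
    rewrite leq_max iN ?orbT.
- exists N => e e' ee' [a pa]; exists a; apply: IH pa => -[|i] //= iN.
  by apply: ee'; exact: ltnW.
Qed.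

Definition renv (rho : nat -> nat + R) e : nat -> R :=
  fun i => match rho i with inl j => e j | inr a => a end.

(* Points of R^N are coded by environments listing their coordinates from the
   last one to the first one, so that the fiber of [P] over [e] is
   [fun y => P (scons y e)].  Each variable of the formula is either read off
   the environment ([inl]) or a parameter ([inr]). *)
Definition Def (P : (nat -> R) -> Prop) : Prop :=
  exists (phi : formula M) (rho : nat -> nat + R),
    forall e, P e <-> holds (renv rho e) phi.

Definition tl e : nat -> R := fun i => e i.+1.

Definition dep (N : nat) (P : (nat -> R) -> Prop) : Prop :=
  forall e e', (forall i, (i < N)%N -> e i = e' i) -> P e -> P e'.

Lemma dep_Def P : Def P -> exists N, dep N P.
Proof.
move=> [phi [rho h]]; have [N NP] := holds_finite_support phi.
(* [k i] is one more than the place of the environment read by variable [i], and [0] for a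
   parameter. *)
pose k (i : nat) := if rho i is inl j then j.+1 else 0%N.
exists (\max_(i < N) k i) => e e' ee' /h he; apply/h; apply: NP he => i iN.
rewrite /renv; have := leq_bigmax (Ordinal iN) (F := fun i : 'I_N => k i).
by rewrite /k /=; case: (rho i) => // j jN; exact: ee'.
Qed.

Lemma Def_ext P Q : (forall e, P e <-> Q e) -> Def P -> Def Q.
Proof.
by move=> PQ [phi [rho h]]; exists phi, rho => e; rewrite -PQ.
Qed.

Lemma Def_not P : Def P -> Def (fun e => ~ P e).
Proof.
by move=> [phi [rho h]]; exists (Not phi), rho => e; rewrite h.
Qed.

(** The two formulas come with unrelated [rho] and [sigma]; moving their variables to the even and
    to the odd indices avoids any clash. *)
Lemma Def_and P Q : Def P -> Def Q -> Def (fun e => P e /\ Q e).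
Proof.
move=> [phi [rho h]] [psi [sigma k]].
exists (And (fren (fun i => i.*2) phi) (fren (fun i => i.*2.+1) psi)).
exists (fun i => if odd i then sigma i./2 else rho i./2) => e.
rewrite h k /= !holds_fren.
have -> : (fun i => renv (fun i => if odd i then sigma i./2 else rho i./2) e
  i.*2) = renv rho e.
  by apply: funext => i; rewrite /renv odd_double doubleK.
have -> // : (fun i => renv (fun i => if odd i then sigma i./2 else rho i./2) e
  i.*2.+1) = renv sigma e.
by apply: funext => i; rewrite /renv /= odd_double uphalf_double.
Qed.

Lemma Def_ex (Q : (nat -> R) -> R -> Prop) :
  Def (fun e => Q (tl e) (e 0%N)) -> Def (fun e => exists a, Q e a).
Proof.
move=> [phi [rho h]].
(* Several variables may read place [0]; all of them become the bound variable. The new assignment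
   gives them the dummy value [inr 0], which is never read. *)
exists (Ex (fren (fun i => if rho i is inl 0%N then 0%N else i.+1) phi)).
exists (fun i => match rho i with
               | inl j.+1 => inl j | inl 0%N => inr 0 | inr a => inr a end) => e.
have E a : (fun i => scons a (renv (fun i => match rho i with
    | inl j.+1 => inl j | inl 0%N => inr 0 | inr a => inr a end) e)
    (if rho i is inl 0%N then 0%N else i.+1)) = renv rho (scons a e).
  by apply: funext => i; rewrite /renv; case Er: (rho i) => [[|j]|b] //=; rewrite Er.
split=> -[a ha]; exists a.
  by apply/holds_fren; rewrite E; apply/h.
by move: ha => /holds_fren; rewrite E => /h.
Qed.

Lemma Def_or P Q : Def P -> Def Q -> Def (fun e => P e \/ Q e).
Proof.
move=> hP hQ; apply: (@Def_ext (fun e => ~ (~ P e /\ ~ Q e))).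
  by move=> e; rewrite not_andP !notE.
by apply: Def_not; apply: Def_and; exact: Def_not.
Qed.

Lemma Def_imp P Q : Def P -> Def Q -> Def (fun e => P e -> Q e).
Proof.
move=> hP hQ; apply: (@Def_ext (fun e => ~ P e \/ Q e)).
  by move=> e; rewrite implyE.
by apply: Def_or => //; exact: Def_not.
Qed.

Lemma Def_iff P Q : Def P -> Def Q -> Def (fun e => P e <-> Q e).
Proof. by move=> hP hQ; apply: Def_and; apply: Def_imp. Qed.

Lemma Def_all (Q : (nat -> R) -> R -> Prop) :
  Def (fun e => Q (tl e) (e 0%N)) -> Def (fun e => forall a, Q e a).
Proof.
move=> hQ; apply: (@Def_ext (fun e => ~ exists a, ~ Q e a)).
  by move=> e; split=> [h a|h [a]//]; apply: contrapT => na; apply: h; exists a.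
by apply: Def_not; apply: Def_ex; exact: Def_not.
Qed.

(** These are the functions that can be substituted by changing [rho] alone, the formula staying the
    same. *)
Definition simple (t : (nat -> R) -> R) : Prop :=
  (exists j, t = fun e => e j) \/ (exists a, t = fun=> a).

Lemma Def_subst P (t : nat -> (nat -> R) -> R) : Def P ->
  (forall i, simple (t i)) -> Def (fun e => P (fun i => t i e)).
Proof.
move=> [phi [rho h]] st.
have /choice[sigma hs] : forall i, exists s : nat + R,
    forall e, t i e = match s with inl j => e j | inr a => a end.
  by move=> i; case: (st i) => [[j ->]|[a ->]]; [exists (inl j)|exists (inr a)].
exists phi, (fun i => if rho i is inl j then sigma j else rho i) => e.
rewrite h; have -> // : renv rho (fun i => t i e) =
  renv (fun i => if rho i is inl j then sigma j else rho i) e.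
apply: funext => i; rewrite /renv; by case: (rho i) => // j; rewrite hs.
Qed.

Definition Dfun (f : (nat -> R) -> R) : Prop := Def (fun e => e 0%N = f (tl e)).

Lemma Def_var_eq i j : Def (fun e => e i = e j).
Proof. by exists (Eq (Var M i) (Var M j)), inl => e. Qed.

Lemma Def_var_lt i j : Def (fun e => e i < e j).
Proof. by exists (Lt (Var M i) (Var M j)), inl => e. Qed.

Lemma Def_var_add i j k : Def (fun e => e i = e j + e k).
Proof. by exists (Eq (Var M i) (Add (Var M j) (Var M k))), inl => e. Qed.

Lemma Dfun_simple t : simple t -> Dfun t.
Proof.
case=> [[j ->]|[a ->]]; first exact: (Def_var_eq 0 j.+1).
apply: (Def_subst (P := fun e => e 0%N = e 1%N)
  (t := fun i => if i == 0%N then fun e => e 0%N else fun=> a)).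
  exact: Def_var_eq.
by move=> [|i]; [left; exists 0%N|right; exists a].
Qed.

Lemma Def_fun (Q : (nat -> R) -> R -> Prop) f :
  Def (fun e => Q (tl e) (e 0%N)) -> Dfun f -> Def (fun e => Q e (f e)).
Proof.
move=> hQ hf; apply: (@Def_ext (fun e => exists a, a = f e /\ Q e a)).
  by move=> e; split=> [[a [-> //]]|h]; exists (f e).
by apply: Def_ex; apply: Def_and.
Qed.

Lemma Dfun_subst f (t : nat -> (nat -> R) -> R) : Dfun f ->
  (forall i, simple (t i)) -> Dfun (fun e => f (fun i => t i e)).
Proof.
move=> hf st; apply: (Def_subst (P := fun e => e 0%N = f (tl e))
  (t := fun i => if i is i'.+1 then fun e => t i' (tl e) else fun e => e 0%N)) => //.
move=> [|i]; first by left; exists 0%N.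
by case: (st i) => [[j ->]|[a ->]]; [left; exists j.+1|right; exists a].
Qed.

Lemma Dfun_tl f : Dfun f -> Dfun (fun e => f (tl e)).
Proof.
move=> hf; apply: (Dfun_subst (t := fun i e => e i.+1)) => // i.
by left; exists i.+1.
Qed.

Lemma Def_eq f g : Dfun f -> Dfun g -> Def (fun e => f e = g e).
Proof.
move=> hf hg.
apply: (Def_fun (Q := fun e a => a = g e)) => //; exact: hg.
Qed.

Lemma Def_lt f g : Dfun f -> Dfun g -> Def (fun e => f e < g e).
Proof.
move=> hf hg.
apply: (Def_fun (Q := fun e a => a < g e)) => //.
apply: (Def_fun (Q := fun e a => e 0%N < a)) (Dfun_tl hg).
exact: Def_var_lt 1 0.
Qed.

Lemma Def_le f g : Dfun f -> Dfun g -> Def (fun e => f e <= g e).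
Proof.
move=> hf hg; apply: (@Def_ext (fun e => ~ (g e < f e))).
  by move=> e; rewrite ltNge; split=> [/negP/negPn|? /negP].
by apply: Def_not; exact: Def_lt.
Qed.

Lemma Def_neq f g : Dfun f -> Dfun g -> Def (fun e => f e != g e).
Proof.
move=> hf hg; apply: (@Def_ext (fun e => ~ (f e = g e))).
  by move=> e; split=> /eqP.
by apply: Def_not; exact: Def_eq.
Qed.

Lemma Def_andb (b c : (nat -> R) -> bool) :
  Def b -> Def c -> Def (fun e => b e && c e).
Proof.
move=> hb hc; apply: (@Def_ext (fun e => b e /\ c e)); last exact: Def_and.
by move=> e; split=> /andP.
Qed.

Lemma Dfun_add f g : Dfun f -> Dfun g -> Dfun (fun e => f e + g e).
Proof.
move=> hf hg; apply: (Def_fun (Q := fun e a => e 0%N = a + g (tl e))).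
  apply: (Def_fun (Q := fun e a => e 1%N = e 0%N + a)).
    exact: Def_var_add 2 1 0.
  exact: Dfun_tl (Dfun_tl hg).
exact: Dfun_tl hf.
Qed.

Lemma Dfun_opp f : Dfun f -> Dfun (fun e => - f e).
Proof.
move=> hf; apply: (@Def_ext (fun e => f (tl e) + e 0%N = 0)).
  by move=> e; split=> [/eqP|->]; rewrite ?subrr // addrC addr_eq0 => /eqP.
apply: Def_eq; last by apply: Dfun_simple; right; exists 0.
apply: Dfun_add; first exact: Dfun_tl.
by apply: Dfun_simple; left; exists 0%N.
Qed.

Lemma Dfun_norm f : Dfun f -> Dfun (fun e => `|f e|).
Proof.
move=> hf; apply: (@Def_ext (fun e => (0 <= f (tl e) /\ e 0%N = f (tl e)) \/
    (f (tl e) <= 0 /\ e 0%N = - f (tl e)))).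
  move=> e; split=> [[[h ->]|[h ->]]|->]; first by rewrite ger0_norm.
    by rewrite ler0_norm.
  by have /orP[h|h] := le_total 0 (f (tl e));
    [left; rewrite ger0_norm|right; rewrite ler0_norm].
have Z : Dfun (fun=> 0) by apply: Dfun_simple; right; exists 0.
have V : Dfun (fun e => e 0%N) by apply: Dfun_simple; left; exists 0%N.
have hf' := Dfun_tl hf.
apply: Def_or; apply: Def_and; first [exact: Def_le | apply: Def_eq => //].
exact: Dfun_opp.
Qed.

Lemma Def_true : Def (fun=> True).
Proof.
by apply: (@Def_ext (fun e => e 0%N = e 0%N)) => //; exact: Def_var_eq.
Qed.

Lemma Def_cst (P : Prop) : Def (fun=> P).
Proof.
have [p|np] := pselect P.
  by apply: Def_ext Def_true.
by apply: Def_ext (Def_not Def_true) => e; split=> // /(_ I).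
Qed.

Lemma Def_forall_fin (I : finType) (P : I -> (nat -> R) -> Prop) :
  (forall i, Def (P i)) -> Def (fun e => forall i, P i e).
Proof.
move=> hP.
have H (s : seq I) : Def (fun e => forall i, i \in s -> P i e).
  elim: s => [|i s IH]; first by apply: Def_ext Def_true.
  apply: Def_ext (Def_and (hP i) IH) => e; split=> [[p q] j|h].
    by rewrite in_cons => /orP[/eqP ->|/q].
  split=> [|j js]; apply: h; rewrite in_cons ?eqxx //.
  by rewrite js orbT.
by apply: Def_ext (H (enum I)) => e; split=> h i //; apply: h; rewrite mem_enum.
Qed.

Lemma Def_exists_fin (I : finType) (P : I -> (nat -> R) -> Prop) :
  (forall i, Def (P i)) -> Def (fun e => exists i, P i e).
Proof.
move=> hP; apply: (@Def_ext (fun e => ~ forall i, ~ P i e)).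
  by move=> e; rewrite -existsNE; split=> -[i]; exists i => //; apply: contrapT.
by apply: Def_not; apply: Def_forall_fin => i; exact: Def_not.
Qed.

(** As [Q e] has at most one element, [Q] itself describes the selected value, apart from the
    default [0] when there is none; no choice among several elements is made. *)
Lemma Dfun_xget (Q : (nat -> R) -> R -> Prop) :
  Def (fun e => Q (tl e) (e 0%N)) ->
  (forall e a b, Q e a -> Q e b -> a = b) ->
  Dfun (fun e => xget 0 [set a | Q e a]).
Proof.
move=> hQ u; apply: (@Def_ext (fun e => Q (tl e) (e 0%N) \/
    ((forall a, ~ Q (tl e) a) /\ e 0%N = 0))).
  move=> e; split=> [[h|[h ->]]|->].
  - by rewrite (@xget_subset1 _ _ [set a | Q (tl e) a] (e 0%N)) // => a b; exact: u.
  - by rewrite xgetPN.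
  - by case: xgetP => [a _ /= h|h]; [left|right].
apply: Def_or => //; apply: Def_and; last exact: Dfun_simple (or_intror (ex_intro _ 0 erefl)).
apply: Def_all; apply: Def_not.
apply: (Def_subst (t := fun i => if i is i'.+1 then fun e => e i'.+2 else fun e => e 0%N)
   (P := fun e => Q (tl e) (e 0%N))) => // -[|i]; left; [by exists 0%N|by exists i.+2].
Qed.



Lemma scons_tl e : scons (e 0%N) (tl e) = e.
Proof. by apply: funext => -[]. Qed.

Lemma tl_scons a e : tl (scons a e) = e.
Proof. by apply: funext. Qed.

(** * Tactics proving definability by recursion on the shape of a predicate, from the definability
    facts in the context *)

Ltac def_simple := by move=> [|[|[|[|[|[|[|[|?]]]]]]]]; rewrite /tl /=;
  first [left; eexists; reflexivity | right; eexists; reflexivity].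

Ltac def_fun :=
  first
  [ solve [apply: Dfun_simple;
           first [left; eexists; reflexivity | right; eexists; reflexivity]]
  | lazymatch goal with
    | |- Dfun (fun e => _ + _) => apply: Dfun_add; def_fun
    | |- Dfun (fun e => - _) => apply: Dfun_opp; def_fun
    | |- Dfun (fun e => `|_|) => apply: Dfun_norm; def_fun
    | H : Dfun ?f |- Dfun (fun e => ?f _) => apply: (Dfun_subst H); def_simple
    | H : Dfun ?f |- Dfun ?f => exact: H
    | H : forall i, Dfun (?f i) |- Dfun (fun e => ?f _ _) =>
        apply: (Dfun_subst (H _)); def_simple
    end
  | idtac ].

Ltac def :=
  cbv beta;
  lazymatch goal with
  | |- Def (fun e => _ /\ _) => apply: Def_and; def
  | |- Def (fun e => _ \/ _) => apply: Def_or; def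
  | |- Def (fun e => _ <-> _) => apply: Def_iff; def
  | |- Def (fun e => ~ _) => apply: Def_not; def
  | |- Def (fun e => @?P e -> @?Q e) => refine (@Def_imp P Q _ _); def
  | |- Def (fun e => exists a : ?T, @?Q e a) => refine (@Def_ex Q _); def
  | |- Def (fun e => forall a : ?T, @?Q e a) => refine (@Def_all Q _); def
  | |- Def (fun e => is_true (_ && _)) => apply: Def_andb; def
  | |- Def (fun e => is_true (_ < _)) => apply: Def_lt; def_fun
  | |- Def (fun e => is_true (_ <= _)) => apply: Def_le; def_fun
  | |- Def (fun e => is_true (_ != _)) => apply: Def_neq; def_fun
  | |- Def (fun e => _ = _) => apply: Def_eq; def_fun
  | H : Def ?A |- Def (fun e => ?A _) => apply: (Def_subst H); def_simple
  | H : Def ?A |- Def ?A => exact: H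
  | H : forall i, Def (?A i) |- Def (fun e => ?A _ _) =>
      apply: (Def_subst (H _)); def_simple
  | |- Def (fun e => ?P) => first [apply: Def_cst | idtac]
  | |- _ => idtac
  end.

Lemma Def_fiber A e : Def A -> Def (fun e' => A (scons (e' 0%N) e)).
Proof. by move=> hA; def. Qed.

(** * Passage between row vectors and environments *)

Definition coord N (x : 'rV[R]_N) (k : nat) : R :=
  if insub k is Some j then x 0 j else 0.

(** The coordinates are listed backwards and [b] continues the list; later [b] will code the point
    of [R^m] over which a fiber is taken. *)
Definition code N (x : 'rV[R]_N) (b : nat -> R) (i : nat) : R :=
  if (i < N)%N then coord x (N - i.+1) else b (i - N)%N.

Lemma Def_definable N P b : Def P -> definable M [set x : 'rV[R]_N | P (code x b)].
Proof.
move=> [phi [rho h]].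
(* Coordinates are put back in increasing order. Any other variable [i] becomes a parameter, which
   [env] finds at index [N + i]. *)
pose f i := if rho i is inl j then if (j < N)%N then (N - j.+1)%N else (N + i)%N
  else (N + i)%N.
exists (fren f phi).
exists (fun i => match rho i with inl j => b (j - N)%N | inr a => a end).
apply: eq_set => x; apply/propext; rewrite h holds_fren.
set e1 := renv _ _; set e2 := (fun i => _); have -> // : e1 = e2.
apply: funext => i; rewrite /e1 /e2 /renv /f /code /env /coord.
case Er: (rho i) => [j|a]; last first.
  by rewrite insubF ?addKn ?Er// ltnNge leq_addr.
case: ltnP => jN; last by rewrite insubF ?addKn ?Er// ltnNge leq_addr.
have lt : (N - j.+1 < N)%N by rewrite ltn_subrL (leq_ltn_trans _ jN).
by rewrite insubT.
Qed.

Lemma definable_Def N (S : set 'rV[R]_N) :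
  definable M S -> Def (fun e => S (\row_j e (N - j.+1)%N)).
Proof.
move=> [phi [c ->]]; exists phi.
exists (fun i => if (i < N)%N then inl (N - i.+1)%N else inr (c (i - N)%N)) => e /=.
set e1 := env _ _; set e2 := renv _ _; have -> // : e1 = e2.
apply: funext => i; rewrite /e1 /e2 /renv /env.
case: ltnP => iN; last by rewrite insubF // ltnNge iN.
by rewrite insubT mxE.
Qed.

(** * Definable sets in one variable *)

Context (hM : locally_o_minimal M).

Definition Def1 (S : set R) := Def (fun e => S (e 0%N)).

(** Local o-minimality enters here: near [a] the set is a finite union of points and open intervals,
    and each of these contains or misses all points just to the right of [a]. *)
Lemma right_germ S (a : R) : Def1 S ->
  (\forall y \near a, a < y -> S y) \/ (\forall y \near a, a < y -> ~ S y).
Proof.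
move=> hS.
have dS : definable M [set v : 'rV[R]_1 | S (v 0 0)].
  have := Def_definable 1 (fun=> 0) hS.
  have -> // : [set x : 'rV[R]_1 | S (code x (fun=> 0) 0)] = [set v | S (v 0 0)].
  apply: eq_set => x; rewrite /code /coord /= insubT //=.
  by congr (S (x _ _)); apply: val_inj; rewrite /= subnn.
have [I [oI Ia [k [P [hP SI]]]]] := hM dS a.
have nI : \forall y \near a, I y.
  move: oI Ia => [c [d [_ ->]]] /= /andP[ca ad].
  by apply: (nbhs_interval ca ad) => y cy yd; apply/andP.
have below (d : \bar R) : (a%:E < d)%E -> \forall y \near a, (y%:E < d)%E.
  by move=> ad; apply: (nbhs_interval (ltNyr a) ad).
have gP i : (\forall y \near a, a < y -> P i y) \/ (\forall y \near a, a < y -> ~ P i y).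
  case: (hP i) => [[c [d [_ ->]]]|[c ->]] /=; last first.
    right; case: (ltP a c) => ac.
      have := below c%:E; rewrite lte_fin => /(_ ac); apply: filterS => y.
      by rewrite lte_fin => yc _ E; rewrite E ltxx in yc.
    by near=> y => ay E; rewrite -E in ac; move: (lt_le_trans ay ac); rewrite ltxx.
  case: (ltP a%:E c) => ac.
    right; apply: filterS (below _ ac) => y yc _ /andP[cy _].
    by move: (lt_trans yc cy); rewrite ltxx.
  case: (ltP a%:E d) => ad.
    left; apply: filterS (below _ ad) => y yd ay; rewrite yd andbT.
    by apply: le_lt_trans ac _; rewrite lte_fin.
  right; near=> y => ay /andP[_ yd].
  by move: (lt_le_trans yd ad); rewrite lte_fin => /(lt_trans ay); rewrite ltxx.
have [[i gi]|gn] := pselect (exists i, \forall y \near a, a < y -> P i y).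
  left; apply: filterS gi => y Pi ay.
  have : (\bigcup_i P i) y by exists i => //; exact: Pi.
  by rewrite -SI => -[].
have /filter_forall gn' : forall i, \forall y \near a, a < y -> ~ P i y.
  by move=> i; case: (gP i) => // ?; exfalso; apply: gn; exists i.
right; apply: filterS2 nI gn' => y Iy Pn ay Sy.
have : (S `&` I) y by [].
by rewrite SI => -[i _]; exact: Pn.
Unshelve. all: by end_near. Qed.

Lemma left_germ S (a : R) : Def1 S ->
  (\forall y \near a, y < a -> S y) \/ (\forall y \near a, y < a -> ~ S y).
Proof.
move=> hS; have hS' : Def1 (fun y => S (- y)).
  by apply: (Def_fun (Q := fun e a => S a)) => //; def_fun.
have N (P : R -> Prop) : (\forall y \near - a, P y) -> \forall y \near a, P (- y).
  by rewrite nearN.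
by have [/N h|/N h] := right_germ (- a) hS'; [left|right];
  apply: filterS h => y; rewrite opprK ltrN2.
Qed.

Definition has_interval (S : set R) := exists c d, c < d /\ forall y, c < y < d -> S y.

(** A one-sided germ contained in [S] would be an interval, so every point has a neighborhood
    containing no other point of [S]; finitely many such neighborhoods cover the segment. *)
Lemma thin_finite S a b : Def1 S -> ~ has_interval S ->
  finite_set (S `&` `[a, b]).
Proof.
move=> hS nS.
have iso x : exists eps : R, 0 < eps /\ forall y, `|x - y| < eps -> S y -> y = x.
  have R1 : \forall y \near x, x < y -> ~ S y.
    have [/nbhs_ballP[eps /= e0 h]|//] := right_germ x hS.
    case: nS; exists x, (x + eps); split; first by rewrite ltrDl.
    move=> y /andP[xy yx]; apply: h => //; rewrite /ball /= ltr0_norm ?subr_lt0//.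
    by rewrite opprB ltrBlDl.
  have L1 : \forall y \near x, y < x -> ~ S y.
    have [/nbhs_ballP[eps /= e0 h]|//] := left_germ x hS.
    case: nS; exists (x - eps), x; split; first by rewrite gtrBl.
    move=> y /andP[xy yx]; apply: h => //; rewrite /ball /= gtr0_norm ?subr_gt0//.
    by rewrite ltrBlDr -ltrBlDl.
  have /nbhs_ballP[eps /= e0 h] : \forall y \near x, (x < y -> ~ S y) /\ (y < x -> ~ S y).
    exact: filterI.
  exists eps; split => // y /h [] h1 h2 Sy.
  by case: (ltgtP x y) => // [/h1|/h2].
have [eps epsP] := choice iso.
have := @segment_compact R a b; rewrite compact_cover.
move=> /(_ R setT (fun x => ball x (eps x))) [].
- by move=> x _; apply: ball_open; case: (epsP x).
- by move=> x _; exists x => //; apply: ballxx; case: (epsP x).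
move=> D _ cov; apply: sub_finite_set (finite_fset D) => y [Sy /cov[x /= xD xy]].
by have [_ /(_ y xy Sy) ->] := epsP x.
Qed.

Lemma infinite_interval S a b : Def1 S -> S `<=` `[a, b] -> infinite_set S ->
  has_interval S.
Proof.
move=> hS Sab nS; apply: contrapT => nI; apply: nS.
by apply: sub_finite_set (thin_finite a b hS nI) => y Sy; split=> //; exact: Sab.
Qed.

Lemma thin_countable S : Def1 S -> ~ has_interval S -> countable S.
Proof.
move=> hS nS; have -> : S = \bigcup_(n in [set: nat]) (S `&` `[- n%:R, n%:R]).
  apply/seteqP; split => [x Sx|x [n _ []] //].
  exists (Num.truncn `|x|).+1 => //; split => //=; rewrite in_itv /= -ler_norml.
  exact: ltW (truncnS_gt _).
by apply: bigcup_countable => // n _; apply: finite_set_countable; exact: thin_finite.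
Qed.

Lemma itv_uncountable (c d : R) : c < d -> ~ countable `]c, d[.
Proof.
move=> cd /countable_lebesgue_measure0; rewrite lebesgue_measure_itv /= lte_fin cd.
by rewrite -EFinD => -[] /eqP; rewrite subr_eq0 => /eqP E; rewrite E ltxx in cd.
Qed.

(** Otherwise each [S i] would meet []c, d[] in a set without interior, hence countable, and []c,
    d[] would be countable. This plays the part of the Baire category theorem. *)
Lemma interval_cover (I : countType) (S : I -> set R) (c d : R) :
  (forall i, Def1 (S i)) -> c < d ->
  (forall y, c < y < d -> exists i, S i y) ->
  exists i c' d', [/\ c' < d', c <= c', d' <= d & forall y, c' < y < d' -> S i y].
Proof.
move=> hS cd cov; apply: contrapT => nn; apply: (itv_uncountable cd).
have -> : `]c, d[%classic = \bigcup_(i in [set: I]) (S i `&` `]c, d[).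
  apply/seteqP; split=> [y /= yI|y [i _ []] //].
  by move: (yI); rewrite in_itv => /cov[i Siy]; exists i.
apply: bigcup_countable => // i _; apply: thin_countable.
  apply: (@Def_ext (fun e => S i (e 0%N) /\ c < e 0%N < d)).
    by move=> e; rewrite /setI /= in_itv.
  by apply: Def_and; [exact: hS|def].
move=> [a [b [ab h]]]; apply: nn; exists i, (Num.max a c), (Num.min b d).
have mid : c < (a + b) / 2 < d.
  have /h [_] : a < (a + b) / 2 < b by rewrite !midf_lt.
  by rewrite /= in_itv.
have [m1 m2] : a < (a + b) / 2 /\ (a + b) / 2 < b by rewrite !midf_lt.
have [m3 m4] := andP mid.
split; rewrite ?le_max ?ge_min ?lexx ?orbT//.
  by apply: (@lt_trans _ _ ((a + b) / 2)); rewrite ?gt_max ?lt_min ?m1 ?m2 ?m3 ?m4.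
move=> y; rewrite gt_max lt_min => /andP[/andP[ay _] /andP[yb _]].
by have [] := h y; rewrite ?ay.
Qed.

(** Connectedness of the interval: the supremum of the points up to which [g] keeps the value [g y]
    cannot lie below [z]. The target is an arbitrary type so that [g] may take sets of numbers or
    propositions as values. *)
Lemma loc_const (T : Type) (g : R -> T) (c d : R) :
  (forall y : R, c < y < d -> exists2 eps : R, 0 < eps &
     forall z, `|z - y| < eps -> g z = g y) ->
  forall y z : R, c < y < d -> c < z < d -> g y = g z.
Proof.
move=> lc.
suff H (y z : R) : c < y -> y <= z -> z < d -> g y = g z.
  move=> y z /andP[cy yd] /andP[cz zd].
  by case: (leP y z) => yz; [apply: H|symmetry; apply: H => //; exact: ltW].
move=> cy yz zd.
pose E : set R := [set t | y <= t <= z /\ forall s : R, y <= s <= t -> g s = g y].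
have Ey : E y.
  split=> [|s]; rewrite ?lexx ?yz // => /andP[a b].
  by congr g; apply/eqP; rewrite eq_le a b.
have ubE : ubound E z by move=> t [/andP[]].
have sE : has_sup E by split; [exists y|exists z].
have ys : y <= sup E by apply: sup_upper_bound.
have sz : sup E <= z by apply: sup_le_ub => //; exists y.
have [|eps e0 epsP] := lc (sup E).
  by rewrite (lt_le_trans cy ys) (le_lt_trans sz zd).
have [t [Et1 Et2] tl] := sup_adherent e0 sE.
have gs : g (sup E) = g y.
  have tsup : t <= sup E by apply: sup_upper_bound.
  rewrite -(Et2 t); last by rewrite lexx; case/andP: Et1 => ->.
  by symmetry; apply: epsP; rewrite ltr_norml; apply/andP; split; lra.
have all (s : R) : y <= s <= z -> s < sup E + eps -> g s = g y.
  move=> /andP[ysn snz] sle; case: (ltP s t) => st.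
    by apply: Et2; rewrite ysn (ltW st).
  rewrite -gs; apply: epsP; rewrite ltr_norml ltrBlDl sle andbT.
  by rewrite ltrBrDl (lt_le_trans tl st).
have : ~ (sup E < z).
  move=> szl; pose w := Num.min z (sup E + eps / 2).
  have Ew : E w.
    have wz : w <= z by rewrite ge_min lexx.
    split.
      by rewrite wz andbT le_min yz (le_trans ys)//= lerDl divr_ge0 // ltW.
    move=> s /andP[ysn sw]; apply: all; first by rewrite ysn (le_trans sw).
    apply: le_lt_trans sw _; rewrite gt_min; apply/orP; right.
    by rewrite ltrD2l ltr_pdivrMr // ltr_pMr // ltr1n.
  have : w <= sup E by apply: sup_upper_bound.
  rewrite ge_min leNgt szl /= leNgt ltrDl divr_gt0 //.
move=> /negP; rewrite -leNgt => zs.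
symmetry; apply: all; rewrite ?yz ?lexx //.
by rewrite (le_lt_trans zs) // ltrDl.
Qed.

(** * Coverings of boxes and generic continuity *)

(** Neighborhoods are taken inside a fiber: the first [n] coordinates move, the later ones are
    parameters and stay fixed. *)
Definition near n e (d : R) e' : Prop :=
  (forall i, (i < n)%N -> `|e' i - e i| < d) /\ (forall i, (n <= i)%N -> e' i = e i).

Lemma near_S n e d e' :
  near n.+1 e d e' <-> `|e' 0%N - e 0%N| < d /\ near n (tl e) d (tl e').
Proof.
split=> [[h1 h2]|[h0 [h1 h2]]]; last by split=> -[|i] //; [exact: h1|exact: h2].
by split; [exact: h1|split=> i hi; [exact: h1|exact: h2]].
Qed.

Lemma near_refl n e d : 0 < d -> near n e d e.
Proof. by move=> d0; split=> // i _; rewrite subrr normr0. Qed.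

Lemma near_le n e d d' e' : d <= d' -> near n e d e' -> near n e d' e'.
Proof. by move=> dd' [h1 h2]; split=> // i /h1 h; exact: lt_le_trans h dd'. Qed.

(** Induction on [n]: over each point of the box in the other variables some [S i] contains an
    interval in variable [0]. With rational endpoints there are countably many possibilities [T p],
    to which the induction hypothesis applies. *)
Lemma box_cover n (I : countType) (S : I -> (nat -> R) -> Prop) e (d : R) :
  (forall i, Def (S i)) -> 0 < d ->
  (forall e', near n e d e' -> exists i, S i e') ->
  exists i e1 (d1 : R), 0 < d1 /\
    forall e', near n e1 d1 e' -> S i e' /\ near n e d e'.
Proof.
elim: n I S e d => [|n IH] I S e d hS d0 cov.
  have [i Si] := cov e (near_refl 0 e d0).
  exists i, e, d; split => // e' [h1 h2]; split; last by split.
  by have -> : e' = e by apply: funext => j; exact: h2.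
pose T (p : I * rat * rat) e' := (ratr p.1.2 < ratr p.2 :> R) /\
  forall y, ratr p.1.2 < y < ratr p.2 -> S p.1.1 (scons y e') /\ `|y - e 0%N| < d.
have hT p : Def (T p).
  by have hSi := hS p.1.1; rewrite /T; def.

have covT e' : near n (tl e) d e' -> exists p, T p e'.
  move=> ne'.
  have [|||i [c [c' [cc' h1 h2 h3]]]] := @interval_cover I
      (fun i y => S i (scons y e')) (e 0%N - d) (e 0%N + d).
  - by move=> i; exact: Def_fiber.
  - lra.
  - move=> y hy; apply: cov; apply/near_S; split => //=.
    by rewrite ltr_distl.
  have [q] := rat_in_itvoo cc'; rewrite in_itv /= => /andP[q1 q2].
  have [q'] := rat_in_itvoo q2; rewrite in_itv /= => /andP[q1' q2'].
  exists (i, q, q'); split=> //= y /andP[y1 y2]; split; first by apply: h3; lra.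
  by rewrite ltr_distl; lra.
have [[[i q] q'] [e1 [d1 [d10 h]]]] := IH _ T (tl e) d hT d0 covT.
have [[/= qq' _] _] := h e1 (near_refl n e1 d10).
set u : R := ratr q in h qq' *; set v : R := ratr q' in h qq' *.
exists i, (scons ((u + v) / 2) e1), (Num.min d1 ((v - u) / 2)).
split; first by rewrite lt_min d10; lra.
move=> e' /near_S[/=]; rewrite tl_scons lt_min => /andP[_ e0] ne.
have [|[/= _ hT'] ne'] := h (tl e').
  by apply: near_le ne; rewrite ge_min lexx.
have [|] := hT' (e' 0%N); first by move: e0; rewrite ltr_distl /u /v; lra.
by rewrite scons_tl => Se ed; split => //; apply/near_S.
Qed.

Definition catn n (u e : nat -> R) (i : nat) : R :=
  if (i < n)%N then u i else e (i - n)%N.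

Lemma catn_S n u e : catn n.+1 u e = scons (u 0%N) (catn n (tl u) e).
Proof. by apply: funext => -[|i] //. Qed.

(** Only the first [n] values of [u] matter, so this is [n] successive quantifiers over reals. *)
Lemma Def_all_catn n P : Def P -> Def (fun e => forall u, P (catn n u e)).
Proof.
elim: n P => [|n IH] P hP.
  apply: Def_ext hP => e; have E u : catn 0 u e = e.
    by apply: funext => i; rewrite /catn subn0.
  by split=> [h u|/(_ e)]; rewrite E.
apply: (@Def_ext (fun e => forall u, forall a : R, P (scons a (catn n u e)))).
  move=> e; split=> [h u|h u a]; first by rewrite catn_S.
  by have := h (scons a u); rewrite catn_S.
by apply: (IH (fun e => forall a : R, P (scons a e))); def.
Qed.

Definition osc_lt n C (f : (nat -> R) -> R) e (eps : R) : Prop :=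
  exists d : R, 0 < d /\ forall e', C e' -> near n e d e' -> `|f e' - f e| < eps.

Definition contat n C f e : Prop := forall eps : R, 0 < eps -> osc_lt n C f e eps.

Definition cont n (C : (nat -> R) -> Prop) f : Prop := forall e, C e -> contat n C f e.

Lemma Def_osc_lt n C f : Def C -> Dfun f ->
  Def (fun e => osc_lt n C f (tl e) (e 0%N)).
Proof.
move=> hC hf; apply: (Def_ex (Q := fun e d => 0 < d /\ forall e', C e' ->
  near n (tl e) d e' -> `|f e' - f (tl e)| < e 0%N)).
apply: Def_and; first def.
(* [X] lists the [n] moving coordinates of [e'], then the radius at [n], the bound at [n.+1], and
   the center from [n.+2] on. [sub] reads off [e'], which has the parameters of the center. *)
pose sub i (X : nat -> R) := if (i < n)%N then X i else X (n + i.+2)%N.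
have sub_simple i : simple (sub i).
  by rewrite /sub; case: (i < n)%N; left; eexists; reflexivity.
pose P0 (X : nat -> R) := C (sub^~ X) ->
    (forall i : 'I_n, `|X i - X (n + i.+2)%N| < X n) ->
     `|f (sub^~ X) - f (fun i => X (n + i.+2)%N)| < X n.+1.
apply: (@Def_ext (fun e => forall u, P0 (catn n u e))); rewrite /P0.
  move=> e.
  have S1 u : sub^~ (catn n u e) = fun i => if (i < n)%N then u i else tl (tl e) i.
    apply: funext => i; rewrite /sub /catn; case: ifP => [-> //|_].
    by rewrite ltnNge leq_addr /= addKn.
  have S2 u : (fun i => catn n u e (n + i.+2)%N) = tl (tl e).
    by apply: funext => i; rewrite /catn ltnNge leq_addr /= addKn.
  have S3 u (i : 'I_n) : catn n u e i = u i by rewrite /catn ltn_ord.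
  have S4 u : catn n u e n = e 0%N by rewrite /catn ltnn subnn.
  have S5 u : catn n u e n.+1 = e 1%N by rewrite /catn ltnNge leqnSn /= subSnn.
  have S6 u i : catn n u e (n + i.+2)%N = tl (tl e) i by rewrite -(S2 u).
  split=> [h e' Ce' [ne1 ne2]|h u].
    have := h e'; rewrite S1 S2 S4 S5.
    have -> : (fun i => if (i < n)%N then e' i else tl (tl e) i) = e'.
      by apply: funext => i; case: ltnP => // /ne2.
    by apply => // i; rewrite S3 S6; exact: ne1.
  rewrite S1 S2 S4 S5 => Cu nu; apply: h => //; split=> i iN.
    by rewrite iN; have := nu (Ordinal iN); rewrite S3 S6.
  by rewrite ltnNge iN.
apply: (Def_all_catn n (P := P0)); apply: Def_imp; first exact: Def_subst.
apply: Def_imp; first by apply: Def_forall_fin => i; def.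
apply: Def_lt; last by def_fun.
apply: Dfun_norm; apply: Dfun_add; first exact: Dfun_subst.
apply: Dfun_opp; apply: (Dfun_subst hf) => i.
by left; eexists; reflexivity.
Qed.

Lemma Def_contat n C f : Def C -> Dfun f -> Def (contat n C f).
Proof.
move=> hC hf; rewrite /contat; have h := Def_osc_lt n hC hf.
apply: Def_all; apply: Def_imp; [def|exact: h].
Qed.

(** Were [f] discontinuous on the whole box, [osc_lt] would fail for one fixed [eta] throughout a
    smaller box, as countably many thresholds suffice. Cutting the values into countably many slabs
    of height [eta] gives a box on which [f] varies by less than [eta]. The multiples of [eta] enter
    as parameters, no multiplication being available. *)
Lemma generic_continuity n f e (d : R) : Dfun f -> 0 < d ->
  exists e', near n e d e' /\ contat n (fun=> True) f e'.
Proof.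
move=> hf d0; apply: contrapT => nc.
pose S (k : nat) e' := ~ osc_lt n (fun=> True) f e' (k.+1%:R^-1).
have hS k : Def (S k).
  apply: Def_not; apply: (Def_fun (Q := osc_lt n (fun=> True) f)).
    exact: Def_osc_lt (Def_cst _) hf.
  by def_fun.
have covS e' : near n e d e' -> exists k, S k e'.
  move=> ne'; apply: contrapT => nS; apply: nc; exists e'; split => // eps eps0.
  have [k hk] : exists k : nat, k.+1%:R^-1 < eps.
    exists (Num.truncn eps^-1); rewrite invf_plt ?posrE //.
    exact: truncnS_gt.
  have : osc_lt n (fun=> True) f e' k.+1%:R^-1.
    by apply: contrapT => nk; apply: nS; exists k.
  move=> [d' [d'0 h]]; exists d'; split => // e'' _ ne''.
  exact: lt_trans (h e'' I ne'') hk.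
have [k [e1 [d1 [d10 h1]]]] := box_cover hS d0 covS.
pose eta : R := k.+1%:R^-1.
have eta0 : 0 < eta by rewrite invr_gt0.
pose T (z : int) e' := z%:~R * eta <= f e' /\ f e' < (z + 1)%:~R * eta.
have hT z : Def (T z) by rewrite /T; def.
have covT e' : near n e1 d1 e' -> exists z, T z e'.
  move=> _; exists (Num.floor (f e' / eta)).
  by rewrite /T -ler_pdivlMr // -ltr_pdivrMr //; apply/andP; exact: floor_itv.
have [z [e2 [d2 [d20 h2]]]] := box_cover hT d10 covT.
have [[T2 T2'] ne2] := h2 e2 (near_refl n e2 d20).
have [Se2 _] := h1 e2 ne2; apply: Se2; exists d2; split => // e3 _ /h2[[T3 T3'] _].
rewrite -/eta ltr_distl; rewrite intrD mulrDl mul1r in T2' T3'; lra.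
Qed.

(** * Uniform finiteness *)

Definition bounded_by (N : nat) (S : set R) : Prop :=
  forall s : seq R, uniq s -> (forall y, y \in s -> S y) -> (size s <= N)%N.

Lemma finite_bounded S : finite_set S -> exists N, bounded_by N S.
Proof.
move=> /finite_seqP[l ->]; exists (size l) => s us sl.
by apply: uniq_leq_size.
Qed.

Lemma bounded_by_inj N (S S' : set R) (h : R -> R) :
  (forall y, S y -> S' (h y)) ->
  (forall y y', S y -> S y' -> h y = h y' -> y = y') ->
  bounded_by N S' -> bounded_by N S.
Proof.
move=> hS hi b s us sS; rewrite -(size_map h); apply: b.
  by rewrite map_inj_in_uniq // => y y' /sS Sy /sS Sy'; exact: hi.
by move=> _ /mapP[y /sS Sy ->]; exact: hS.
Qed.

Lemma bounded_by_sub N (S S' : set R) : S `<=` S' -> bounded_by N S' -> bounded_by N S.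
Proof. by move=> SS'; apply: (@bounded_by_inj _ _ _ id). Qed.

Lemma bounded_by_leq N N' S : (N <= N')%N -> bounded_by N S -> bounded_by N' S.
Proof. by move=> NN' b s us sS; apply: leq_trans NN'; exact: b. Qed.

Lemma finite_max (T : set R) : finite_set T -> T !=set0 ->
  exists2 a, T a & forall x, T x -> x <= a.
Proof.
move=> /finite_seqP[l ->] [x0 /= x0l].
have: has predT l by apply/hasP; exists x0.
elim: l {x0l} => // x l IH _.
have [hl|nl] := boolP (has predT l); last first.
  exists x => [|y]; rewrite /= ?mem_head // in_cons => /orP[/eqP ->//|yl].
  by move/hasPn: nl => /(_ y yl).
have [a /= al am] := IH hl; exists (Num.max a x).
  by rewrite /= /Num.max; case: ifP => _; rewrite in_cons ?eqxx ?al ?orbT.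
by move=> y /=; rewrite in_cons le_max => /orP[/eqP ->|/am ->//]; rewrite lexx orbT.
Qed.

Lemma finite_min (T : set R) : finite_set T -> T !=set0 ->
  exists2 a, T a & forall x, T x -> a <= x.
Proof.
move=> fT [x0 Tx0].
have [|_ [a Ta <-] h] := finite_max (finite_image (-%R) fT); first by exists (- x0), x0.
by exists a => // x Tx; rewrite -lerN2; apply: h; exists x.
Qed.

(** Distinct elements have a least distance. The gap takes the form [2/(k+1)] so that
    [interval_cover] can be applied to the countably many values of [k]. *)
Lemma finite_gap (S : set R) : finite_set S ->
  exists k : nat, forall y y', S y -> S y' -> y != y' ->
    k.+1%:R^-1 + k.+1%:R^-1 <= `|y - y'|.
Proof.
move=> fS.
pose D := [set `|p.1 - p.2| | p in [set p | S p.1 /\ S p.2 /\ p.1 != p.2]].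
have fD : finite_set D.
  apply: finite_image; apply: sub_finite_set (finite_setX fS fS) => p /= [? []].
  by split.
have [[x Dx]|D0] := pselect (D !=set0); last first.
  by exists 0%N => y y' Sy Sy' yy'; exfalso; apply: D0; exists `|y - y'|, (y, y').
have [a [[p1 p2] /= [_ [_ p12]] ea] h] := finite_min fD (ex_intro _ x Dx).
have a0 : 0 < a by rewrite -ea normr_gt0 subr_eq0.
exists (Num.truncn (a / 2)^-1) => y y' Sy Sy' yy'.
apply: (@le_trans _ _ a); last by apply: h; exists (y, y').
have : (Num.truncn (a / 2)^-1).+1%:R^-1 <= a / 2 :> R.
  by rewrite invf_ple ?posrE ?divr_gt0 // ltW // truncnS_gt.
by set z := _.+1%:R^-1; lra.
Qed.

(** * Finite sets varying with one bounded parameter *)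

Section OneParameter.
Context (A : (nat -> R) -> Prop) (hA : Def A).

(* A first-order condition on [X = scons t e] forcing the number of elements of
   [A_(t,e)] to be locally constant in [t]. *)
Definition good (X : nat -> R) : Prop :=
  exists eps : R, 0 < eps /\ exists d : R, 0 < d /\ forall t1 t2 : R,
    `|t1 - X 0%N| < d -> `|t2 - X 0%N| < d ->
    (forall y y' : R, A (scons y (scons t1 (tl X))) -> A (scons y' (scons t1 (tl X))) ->
       y != y' -> eps + eps <= `|y - y'|) /\
    (forall y : R, A (scons y (scons t1 (tl X))) ->
       exists y' : R, A (scons y' (scons t2 (tl X))) /\ `|y - y'| < eps).

Lemma Def_good : Def good.
Proof. by rewrite /good; def. Qed.

(** The set of all upper bounds stands for the cardinality of [A_(t,e)]. *)
Definition bounds e t : set nat := [set N | bounded_by N [set y | A (scons y (scons t e))]].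

(** Sending each point of one nearby fiber to a point of another within [eps] is injective: two
    points with the same image would be less than [2 eps] apart. *)
Lemma good_bounds e t : good (scons t e) ->
  exists2 d : R, 0 < d & forall t', `|t' - t| < d -> bounds e t' = bounds e t.
Proof.
move=> [eps [eps0 [d [d0 /= h]]]]; exists d => //.
have tt : `|t - t| < d by rewrite subrr normr0.
suff H t1 t2 : `|t1 - t| < d -> `|t2 - t| < d -> bounds e t1 `<=` bounds e t2.
  by move=> t' tt'; apply/seteqP; split; exact: H.
move=> h1 h2 N; rewrite /bounds /=.
have /choice[k kP] : forall y, exists y', A (scons y (scons t2 e)) ->
    A (scons y' (scons t1 e)) /\ `|y - y'| < eps.
  move=> y; have [Ay|nAy] := pselect (A (scons y (scons t2 e))); last by exists 0.
  by have [y' hy'] := (h _ _ h2 h1).2 y Ay; exists y'.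
apply: (bounded_by_inj (h := k)) => [y /= /kP[]//|y y' /= Ay Ay' kk].
apply: contrapT => /eqP yy'.
have := (h _ _ h2 h1).1 y y' Ay Ay' yy'.
have [_] := kP _ Ay; have [_] := kP _ Ay'; rewrite kk.
have := ler_distD (k y') y y'; rewrite [`|k y' - y'|]distrC; lra.
Qed.

(* Some gap size [2 eps] works on a subinterval, and there are finitely many
   patterns of occupied slots of length [eps]. *)
Lemma good_dense e c d : c < d ->
  (forall t, c < t < d -> finite_set [set y | A (scons y (scons t e))]) ->
  (forall t y, c < t < d -> A (scons y (scons t e)) -> -1 < y < 1) ->
  exists t, c < t < d /\ good (scons t e).
Proof.
move=> cd fA bA.
pose S (k : nat) (t : R) := forall y y' : R, A (scons y (scons t e)) ->
  A (scons y' (scons t e)) -> y != y' -> k.+1%:R^-1 + k.+1%:R^-1 <= `|y - y'|.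
have [|t /fA /finite_gap //|k [c1 [d1 [cd1 cc1 dd1 hk]]]] := interval_cover (S := S) _ cd.
  by move=> k; rewrite /Def1 /S; def.
pose eps : R := k.+1%:R^-1.
have eps0 : 0 < eps by rewrite invr_gt0.
(* The first [2 * k.+1] slots, of length [1/(k+1)], cover [[-1, 1)]; [T p] says that [p] is the set
   of occupied ones. *)
pose slot (j : nat) (y : R) := -1 + j%:R * eps <= y /\ y < -1 + j.+1%:R * eps.
pose T (p : {set 'I_(2 * k.+1)}) (t : R) := forall j : 'I_(2 * k.+1),
  (exists y : R, A (scons y (scons t e)) /\ slot j y) <-> j \in p.
have [||p [c2 [d2 [cd2 cc2 dd2 hp]]]] := interval_cover (S := T) _ cd1.
- by move=> p; apply: Def_forall_fin => j; rewrite /slot; def.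
- move=> t _.
  exists [set j : 'I_(2 * k.+1) | `[< exists y, A (scons y (scons t e)) /\ slot j y >]]%SET.
  by move=> j; rewrite inE; split=> /asboolP.
exists ((c2 + d2) / 2); split; first lra.
exists eps; split=> //; exists ((d2 - c2) / 2); split; first lra.
move=> t1 t2 /=; rewrite !ltr_distl => h1 h2; split.
  by apply: (hk t1); lra.
move=> y Ay.
have yb : -1 < y < 1 by apply: (bA t1) => //; lra.
pose j := Num.truncn ((y + 1) / eps).
have y1 : 0 <= (y + 1) / eps by rewrite divr_ge0 //; lra.
have /andP[j1 j2] := truncn_itv y1; rewrite -/j in j1 j2.
rewrite ler_pdivlMr // in j1; rewrite ltr_pdivrMr // in j2.
have jk : (j < 2 * k.+1)%N.
  rewrite -(ltr_nat R) natrM; apply: (@le_lt_trans _ _ ((y + 1) / eps)).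
    by rewrite ler_pdivlMr.
  by rewrite /eps invrK ltr_pM2r //; lra.
have t1p : c2 < t1 < d2 by lra.
have t2p : c2 < t2 < d2 by lra.
have /(hp _ t1p (Ordinal jk)) /(hp _ t2p (Ordinal jk)) [y' [Ay' [s1 s2]]] :
    exists y, A (scons y (scons t1 e)) /\ slot (Ordinal jk) y.
  by exists y; split=> //; split=> /=; lra.
exists y'; split=> //; rewrite ltr_distl; move: s1 s2; rewrite /=.
by rewrite -[in _.+1]addn1 natrD mulrDl mul1r; move: j2;
  rewrite -[in _.+1]addn1 natrD mulrDl mul1r; lra.
Qed.

(** The endpoints are included so that every other point of [[-1, 1]] has bad points on both
    sides. *)
Definition bad e : set R := [set t | (-1 < t < 1 /\ ~ good (scons t e)) \/ t = -1 \/ t = 1].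

(** Midpoints of pairs of bad points, expressed by addition alone; [a = b] yields the bad points
    themselves. *)
Definition samples e : set R := [set s | exists a b : R, bad e a /\ bad e b /\ s + s = a + b].

(** Infinitely many bad points would fill an interval, against the density of good ones. *)
Lemma finite_bad e :
  (forall t, -1 <= t <= 1 -> finite_set [set y | A (scons y (scons t e))]) ->
  (forall t y, -1 <= t <= 1 -> A (scons y (scons t e)) -> -1 < y < 1) ->
  finite_set (bad e).
Proof.
move=> fA bA.
have -> : bad e = [set t | -1 < t < 1 /\ ~ good (scons t e)] `|` [set -1; 1] by [].
rewrite finite_setU; split; last by rewrite finite_setU; split; exact: finite_set1.
apply: contrapT => /(@infinite_interval _ (-1) 1) [].
- by have h := Def_good; rewrite /Def1 /=; def.
- by move=> t /= [/andP[a b] _]; rewrite in_itv /= !ltW.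
move=> c [d [cd h]].
have hb t : c < t < d -> -1 <= t <= 1 by move=> /h [] /andP[a b] _; rewrite !ltW.
have [|t y /hb|t [/h [_ ng] //]] := @good_dense e c d cd; last exact: bA.
by move=> t /hb; exact: fA.
Qed.

(** A bad [t] is its own sample. Any other [t] lies between two neighboring bad points; all
    parameters between them are good, so [bounds] is constant there and agrees with its value at the
    midpoint. *)
Lemma samples_bounds e : finite_set (bad e) ->
  forall t, -1 <= t <= 1 ->
    exists s, samples e s /\ -1 <= s <= 1 /\ bounds e t = bounds e s.
Proof.
move=> fb t tb.
have [bt|nbt] := pselect (bad e t); first by exists t; split=> //; exists t, t.
have b1 : bad e (-1) by right; left.
have b2 : bad e 1 by right; right.
have t1 : -1 < t < 1.
  by rewrite !lt_neqAle; move: tb => /andP[-> ->]; rewrite !andbT; apply/andP; split;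
    apply/eqP => E; apply: nbt; rewrite -?E // E.
have [|a [/= ba ta] amax] := finite_max (sub_finite_set (@subIsetl _ (bad e) [set x | x < t]) fb).
  by exists (-1); split=> //=; lra.
have [|b [/= bb tb'] bmin] := finite_min (sub_finite_set (@subIsetl _ (bad e) [set x | t < x]) fb).
  by exists 1; split=> //=; lra.
have aM : -1 <= a by apply: amax; split=> //=; lra.
have bM : b <= 1 by apply: bmin; split=> //=; lra.
exists ((a + b) / 2); split; first by exists a, b; split=> //; split=> //; lra.
split; first lra.
apply: (@loc_const _ (bounds e) a b); [|lra|lra].
move=> y yab; apply: good_bounds; apply: contrapT => ng.
have by_ : bad e y by left; split=> //; lra.
case: (ltgtP y t) => yt.
- have := amax y (conj by_ yt); lra.
- have := bmin y (conj by_ yt); lra.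
- by apply: nbt; rewrite -yt.
Qed.

End OneParameter.

(* Only environments supported on the first [m] variables are considered, so
   that an induction on the number of parameters is possible. *)
Definition supp m e : Prop := forall i, (m <= i)%N -> e i = 0.

Definition small_fiber A e : Prop :=
  finite_set [set y | A (scons y e)] /\ forall y : R, A (scons y e) -> -1 < y < 1.

Definition UF m : Prop := forall A, Def A -> (forall e, supp m e -> small_fiber A e) ->
  exists N, forall e, supp m e -> bounded_by N [set y | A (scons y e)].

Lemma UF0 : UF 0.
Proof.
move=> A hA h; have h0 : supp 0 (fun=> 0) by [].
have [N hN] := finite_bounded (h _ h0).1; exists N => e se.
by have -> : e = fun=> 0 by apply: funext => i; rewrite se.
Qed.

(** The union [U] over the finitely many samples is a definable family with parameter [e] alone. Its
    bound from [UF m] serves for each [A_(s,e)] with [s] a sample in [[-1, 1]], hence for every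
    [A_(t,e)]. *)
Lemma UF_bounded_parameter m A : UF m -> Def A ->
  (forall (t : R) e, -1 <= t <= 1 -> supp m e -> small_fiber A (scons t e)) ->
  exists N, forall (t : R) e, -1 <= t <= 1 -> supp m e ->
    bounded_by N [set y | A (scons y (scons t e))].
Proof.
move=> uf hA h.
pose U (X : nat -> R) := exists s : R,
  (exists a b : R, bad A (tl X) a /\ bad A (tl X) b /\ s + s = a + b) /\
  -1 <= s <= 1 /\ A (scons (X 0%N) (scons s (tl X))).
have hU : Def U by have hg := Def_good hA; rewrite /U /bad /mkset; def.
have fb e : supp m e -> finite_set (bad A e).
  by move=> se; apply: finite_bad => // [t tb|t y tb];
    [exact: (h t e tb se).1|exact: (h t e tb se).2].
have [e se|N hN] := uf U hU.
  split.
    have -> : [set y | U (scons y e)] = \bigcup_(s in samples A e `&` `[-1, 1])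
        [set y | A (scons y (scons s e))].
      apply/seteqP; split=> [y [s /= [sS [sb As]]]|y [s [/= sS sb] As]].
        by exists s => //; split=> //=; rewrite in_itv.
      by exists s; split => //; split=> //; rewrite in_itv in sb.
    apply: bigcup_finite => [|s [_ /=]]; last by rewrite in_itv => sb; case: (h s e sb se).
    apply: finite_setIl.
    apply: (sub_finite_set _ (finite_image (fun p => (p.1 + p.2) / 2)
      (finite_setX (fb _ se) (fb _ se)))).
    move=> s [a [b [ba [bb ss]]]]; exists (a, b) => //=; lra.
  by move=> y [s [_ [sb /=]]]; rewrite tl_scons; exact: (h s e sb se).2.
exists N => t e tb se.
have [s [sS [sb E]]] := samples_bounds (fb e se) tb.
have : bounds A e s N.
  by apply: bounded_by_sub (hN e se) => y /= Ay; exists s.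
by rewrite -E.
Qed.

Lemma UF_S m : UF m -> UF m.+1.
Proof.
move=> uf A hA h.
(* [X] lists [z], [y], [e], and the condition says that [z] lies in [P_(y,e)]. *)
pose P (X : nat -> R) := exists t : R, A (scons (X 1%N) (scons t (tl (tl X)))) /\
  A (scons (X 0%N) (scons t (tl (tl X)))).
have hP : Def P by rewrite /P; def.
(* This is [F_e]. Infinitude of [P_(y,e)] is not a first-order condition, but for a definable subset
   of [(-1, 1)] it amounts to containing an interval. *)
pose Inf (X : nat -> R) := -1 < X 0%N < 1 /\ exists c d : R, c < d /\
  forall y : R, c < y < d -> P (scons y X).
have hInf : Def Inf by rewrite /Inf; def.
have h' t e : supp m e -> small_fiber A (scons t e).
  by move=> se; apply: h => -[|i] //= /se.
have Pb y1 y2 e : supp m e -> P (scons y2 (scons y1 e)) -> (-1 < y1 < 1) /\ (-1 < y2 < 1).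
  move=> se [t [/=]]; rewrite !tl_scons => A1 A2.
  by have [_ hb] := h' t e se; split; exact: hb.
have fInf e : supp m e -> small_fiber Inf e.
  move=> se; split; last by move=> y [].
  apply: contrapT => /(@infinite_interval _ (-1) 1) [].
  - by rewrite /Def1 /=; def.
  - by move=> y [/= /andP[a b] _]; rewrite in_itv /= !ltW.
  move=> c [d [cd hcd]]; apply: (itv_uncountable cd).
  have sub : `]c, d[ `<=` \bigcup_(q in [set: rat]) [set y | A (scons y (scons (ratr q) e))].
    move=> y /=; rewrite in_itv => /hcd [_ [u [v [uv huv]]]].
    have [[a [b [ab hab]]]|nQ] := pselect (has_interval [set t | A (scons y (scons t e))]).
      have [q] := rat_in_itvoo ab; rewrite in_itv => hq.
      by exists q => //; exact: hab.
    exfalso; apply: (itv_uncountable uv).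
    have : `]u, v[ `<=` \bigcup_(t in [set t | A (scons y (scons t e))])
        [set z | A (scons z (scons t e))].
      move=> z /=; rewrite in_itv => /huv [t [/=]]; rewrite !tl_scons => A1 A2.
      by exists t.
    move=> /subset_card_le /sub_countable; apply; apply: bigcup_countable.
      by apply: thin_countable nQ; rewrite /Def1 /=; def.
    by move=> t _; apply: finite_set_countable; case: (h' t e se).
  apply: sub_countable (subset_card_le sub) _; apply: bigcup_countable => // q _.
  by apply: finite_set_countable; case: (h' (ratr q) e se).
have [K1 hK1] := uf Inf hInf fInf.
(* Emptying the fibers over [F_e] makes [P_(y,e)] finite for every value of the bounded parameter
   [y]. *)
pose Q (X : nat -> R) := P X /\ ~ Inf (tl X).
have [||K2 hK2] := @UF_bounded_parameter m Q uf.
- by rewrite /Q; def.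
- move=> t e tb se; split; last by move=> y [/(Pb _ _ _ se)[]].
  apply: contrapT => /(@infinite_interval _ (-1) 1) [].
  + by rewrite /Def1 /Q /=; def.
  + by move=> y [/(Pb _ _ _ se)[_ /andP[a b]] _]; rewrite /= in_itv /= !ltW.
  move=> c [d [cd hcd]].
  have /hcd [/(Pb _ _ _ se)[tb' _]] : c < (c + d) / 2 < d by rewrite !midf_lt.
  by apply; split => //; exists c, d; split => // y /hcd [].
exists (maxn K1 K2) => e se.
have se' : supp m (tl e) by move=> i hi; exact: se.
have Eh y : A (scons y e) -> -1 < y < 1 by apply: (h e se).2.
have [sub|] := pselect (forall y, A (scons y e) -> Inf (scons y (tl e))).
  apply: (@bounded_by_leq K1); first exact: leq_maxl.
  by apply: bounded_by_sub (hK1 _ se') => y /sub.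
move=> /existsNP [y /not_implyP [Ay nI]].
apply: (@bounded_by_leq K2); first exact: leq_maxr.
have yb : -1 <= y <= 1 by have /andP[a b] := Eh y Ay; rewrite !ltW.
apply: bounded_by_sub (hK2 y (tl e) yb se') => z Az; split=> //.
by exists (e 0%N); rewrite /= !tl_scons scons_tl.
Qed.

(** [A] depends on finitely many variables, so all the later parameters can be set to [0]. *)
Lemma uniform_finiteness A : Def A -> (forall e, small_fiber A e) ->
  exists N, forall e, bounded_by N [set y | A (scons y e)].
Proof.
move=> hA h; have [m hm] := dep_Def hA.
have uf : UF m by elim: m {hm} => [|m]; [exact: UF0|exact: UF_S].
have [e _|N hN] := uf A hA; first exact: h.
exists N => e; pose e' i := if (i < m)%N then e i else 0.
have se' : supp m e' by move=> i; rewrite /e' ltnNge => ->.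
apply: bounded_by_sub (hN e' se') => y /=; apply: hm => -[|i] //= im.
by rewrite /e' (ltnW im).
Qed.

(** * Fiberwise cell decomposition *)

(** Only the first [n] variables are confined; the parameters behind them range over all reals. *)
Definition box n e : Prop := forall i, (i < n)%N -> -1 < e i < 1.

Definition graphE C f e : Prop := C (tl e) /\ e 0%N = f (tl e).

Definition bandE C f g e : Prop := C (tl e) /\ f (tl e) < e 0%N < g (tl e).

Definition stacked n C (X : (nat -> R) -> Prop) : Prop :=
  (exists f, [/\ Dfun f, cont n C f & X = graphE C f]) \/
  (exists f g, [/\ Dfun f /\ cont n C f, Dfun g /\ cont n C g,
     forall e, C e -> f e < g e & X = bandE C f g]).

Definition is_part (I : Type) (X : I -> (nat -> R) -> Prop) (B : (nat -> R) -> Prop) : Prop :=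
  (forall e, B e <-> exists i, X i e) /\ (forall i j e, X i e -> X j e -> i = j).

(* The members of a decomposition may be empty, and so may the fibers of
   nonempty members. *)
Fixpoint pdec (n : nat) (I : finType) (X : I -> (nat -> R) -> Prop) : Prop :=
  is_part X (box n) /\
  if n is n'.+1 then
    exists (I' : finType) (X' : I' -> (nat -> R) -> Prop),
      [/\ pdec n' X', forall i, (forall e, ~ X i e) \/ exists i', stacked n' (X' i') (X i) &
          forall i', exists i, stacked n' (X' i') (X i)]
  else forall i, Def (X i).

Definition compat (I L : Type) (X : I -> (nat -> R) -> Prop)
    (A : L -> (nat -> R) -> Prop) : Prop :=
  forall i l, (forall e, X i e -> A l e) \/ (forall e, X i e -> ~ A l e).

Definition Decomp n : Prop := forall (L : finType) (A : L -> (nat -> R) -> Prop),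
  (forall l, Def (A l)) -> exists (I : finType) (X : I -> (nat -> R) -> Prop),
    pdec n X /\ compat X A.

(** Piecewise continuity: the pieces form a cover, may overlap, and may reach outside [C]. *)
Definition Pieces n f (C : (nat -> R) -> Prop) : Prop :=
  exists (J : finType) (W : J -> (nat -> R) -> Prop),
    [/\ forall j, Def (W j), forall e, C e -> exists j, W j e &
        forall j, cont n (W j) f].

Lemma pdec_part n (I : finType) (X : I -> (nat -> R) -> Prop) : pdec n X -> is_part X (box n).
Proof. by case: n => [|n] []. Qed.

Lemma stacked_Def n C X : Def C -> stacked n C X -> Def X.
Proof.
move=> hC [[f [hf _ ->]]|[f [g [[hf _] [hg _] _ ->]]]].
  by rewrite /graphE; def.
by rewrite /bandE; def.
Qed.

Lemma pdec_Def n (I : finType) (X : I -> (nat -> R) -> Prop) i : pdec n X -> Def (X i).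
Proof.
elim: n I X i => [|n IH] I X i [] //= _ [I' [X' [h1 h2 _]]].
have [h|[i' h]] := h2 i; last exact: stacked_Def (IH _ _ i' h1) h.
by apply: Def_ext (Def_cst False) => e; split=> // /h.
Qed.

(** * Open and thin members of a decomposition, and piecewise continuity *)

Definition openE n C : Prop :=
  forall e, C e -> exists d : R, 0 < d /\ forall e', near n e d e' -> C e'.

Definition thin n C : Prop := exists p, (p < n)%N /\
  forall e e', C e -> C e' -> (forall q, q != p -> e q = e' q) -> e = e'.

(** On a graph, variable [0] is determined by the others. A band over a thin set is thin in the same
    coordinate, shifted by one; a band over an open set is open because its two bounds are
    continuous. *)
Lemma stacked_open_or_thin n C X : openE n C \/ thin n C -> stacked n C X ->
  openE n.+1 X \/ thin n.+1 X.
Proof.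
move=> h [[f [_ _ ->]]|[f [g [[_ cf] [_ cg] _ ->]]]].
  right; exists 0%N; split => // e e' [_ e0] [_ e0'] ee'.
  have E : tl e = tl e' by apply: funext => i; exact: ee'.
  by rewrite -(scons_tl e) -(scons_tl e') e0 e0' E.
case: h => [oC|[p [pn hp]]]; last first.
  right; exists p.+1; split => // e e' [Ce _] [Ce' _] ee'.
  rewrite -(scons_tl e) -(scons_tl e') (ee' 0%N) //.
  by rewrite (hp (tl e) (tl e')) // => q qp; exact: ee'.
left => e [Ce /andP[fe ge]].
have [d1 [d10 h1]] := oC _ Ce.
have e1 : 0 < (e 0%N - f (tl e)) / 2 by lra.
have e2 : 0 < (g (tl e) - e 0%N) / 2 by lra.
have [d2 [d20 h2]] := cf _ Ce _ e1; have [d3 [d30 h3]] := cg _ Ce _ e2.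
pose d := Num.min (Num.min d1 (Num.min d2 d3))
  (Num.min ((e 0%N - f (tl e)) / 2) ((g (tl e) - e 0%N) / 2)).
exists d; split; first by rewrite !lt_min d10 d20 d30 e1 e2.
move=> e' /near_S[]; rewrite !lt_min => /andP[_ /andP[a1 a2]] ne.
have Ce' : C (tl e') by apply: h1; apply: near_le ne; rewrite !ge_min lexx.
have ne2 : near n (tl e) d2 (tl e') by apply: near_le ne; rewrite !ge_min lexx ?orbT.
have ne3 : near n (tl e) d3 (tl e') by apply: near_le ne; rewrite !ge_min lexx ?orbT.
have := h2 _ Ce' ne2; have := h3 _ Ce' ne3; move: a1 a2; rewrite !ltr_distl => a1 a2 a3 a4.
by split => //; lra.
Qed.

Lemma pdec_open_or_thin n (I : finType) (X : I -> (nat -> R) -> Prop) i :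
  pdec n X -> openE n (X i) \/ thin n (X i).
Proof.
elim: n I X i => [|n IH] I X i [] /= _.
  move=> _; left => e Xe; exists 1; split => // e' [_ h].
  by have -> : e' = e by apply: funext => j; exact: h.
move=> [I' [X' [h1 h2 _]]].
have [h|[i' h]] := h2 i; first by left => e /h.
exact: stacked_open_or_thin (IH _ _ i' h1) h.
Qed.

Lemma Pieces_union n f (I : finType) (X : I -> (nat -> R) -> Prop) C :
  (forall i, Pieces n f (X i)) -> (forall e, C e -> exists i, X i e) -> Pieces n f C.
Proof.
move=> h cov.
have /choice[JW hJW] : forall i, exists JW : {J : finType & J -> (nat -> R) -> Prop},
    [/\ forall j, Def (projT2 JW j), forall e, X i e -> exists j, projT2 JW j e &
        forall j, cont n (projT2 JW j) f].
  by move=> i; have [J [W hW]] := h i; exists (existT _ J W).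
exists {i : I & projT1 (JW i)}, (fun p => projT2 (JW (tag p)) (tagged p)).
split=> [[i j]|e /cov[i Xe]|[i j]].
- by case: (hJW i).
- by have [_ /(_ e Xe) [j Wj] _] := hJW i; exists (Tagged (fun i => projT1 (JW i)) j).
- by case: (hJW i).
Qed.

Definition ins p (a : R) e (i : nat) : R :=
  if (i < p)%N then e i else if i == p then a else e i.-1.

Definition del p e (i : nat) : R := if (i < p)%N then e i else e i.+1.

Lemma ins_del p e : ins p (e p) (del p e) = e.
Proof.
apply: funext => i; rewrite /ins /del; case: (ltngtP i p) => // [pi|->//].
by case: i pi => // i; rewrite ltnS /= ltnNge => ->.
Qed.

(* The coordinate that is determined by the other ones is deleted. *)
Lemma Pieces_thin n f X : Dfun f -> Def X -> thin n.+1 X ->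
  (forall e, X e -> box n.+1 e) ->
  (forall f', Dfun f' -> Pieces n f' (box n)) -> Pieces n.+1 f X.
Proof.
move=> hf hX [p [pn hp]] Xb pcs.
have u e a b : X (ins p a e) -> X (ins p b e) -> a = b.
  move=> Xa Xb'; have E : ins p a e = ins p b e.
    by apply: hp => // q qp; rewrite /ins; case: ifP => // _; rewrite (negbTE qp).
  by have := congr1 (@^~ p) E; rewrite /ins ltnn eqxx.
(* [k] recovers the deleted coordinate; its default value [0] off the projection of [X] is harmless,
   since the pieces are intersected with [X]. *)
pose k e := xget 0 [set a | X (ins p a e)].
have s1 i : simple (fun e => ins p (e 0%N) (tl e) i).
  by rewrite /ins; case: (i < p)%N; [|case: (i == p)]; left; eexists; reflexivity.
have hk : Dfun k.
  apply: (Dfun_xget (Q := fun e a => X (ins p a e))) => //.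
  exact: (Def_subst (t := fun i e => ins p (e 0%N) (tl e) i)).
pose f' e := f (ins p (k e) e).
have hf' : Dfun f'.
  apply: (Def_fun (Q := fun e a => e 0%N = f (ins p a (tl e))) (f := fun e => k (tl e))).
    apply: Def_eq; first by def_fun.
    apply: (Dfun_subst (t := fun i e => ins p (e 0%N) (tl (tl e)) i)) => // i.
    by rewrite /ins; case: (i < p)%N; [|case: (i == p)]; left; eexists; reflexivity.
  exact: Dfun_tl.
have f'E e : X e -> f' (del p e) = f e.
  move=> Xe; rewrite /f' -[in RHS](ins_del p e); congr (f (ins _ _ _)).
  rewrite /k; apply: (u (del p e)); last by rewrite ins_del.
  by case: xgetP => //= /(_ (e p)); rewrite ins_del.
have [J [W [hW covW cW]]] := pcs f' hf'.
exists J, (fun j e => X e /\ W j (del p e)); split => [j|e Xe|j e [Xe We]].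
- apply: Def_and => //; apply: (Def_subst (t := fun i e => del p e i)) => // i.
  by rewrite /del; case: (i < p)%N; left; eexists; reflexivity.
- have [|j Wj] := covW (del p e); last by exists j.
  by move=> i iN; rewrite /del; case: ifP => _; apply: Xb => //; exact: ltnW.
- move=> eps eps0; have [d [d0 h]] := cW j _ We eps eps0.
  exists d; split => // e' [Xe' We'] [n1 n2].
  rewrite -(f'E e) // -(f'E e') //; apply: h => //; split=> i iN; rewrite /del.
    by case: ifP => _; apply: n1 => //; exact: ltnW.
  by rewrite ltnNge (leq_trans _ iN) //= n2.
Qed.

(** The decomposition respects the set of discontinuities of [f]. An open member contains a point of
    continuity, hence consists of such points; a thin member, possible only for positive [n], is
    handled in one variable less. *)
Lemma Pieces_of_Decomp n f : Dfun f -> Decomp n ->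
  (forall n', n = n'.+1 -> forall f', Dfun f' -> Pieces n' f' (box n')) ->
  Pieces n f (box n).
Proof.
move=> hf dn pcs.
have [|I [X [pX cX]]] := dn unit (fun _ e => ~ contat n (fun=> True) f e).
  by move=> _; apply: Def_not; apply: Def_contat => //; exact: Def_cst.
have [pX1 pX2] := pdec_part pX.
apply: (Pieces_union (X := X)); last by move=> e /pX1.
move=> i; have [oX|tX] := pdec_open_or_thin i pX.
  exists unit, (fun=> X i); split=> [_|e Xe|_ e Xe]; [exact: pdec_Def pX|by exists tt|].
  have [XD|XD] := cX i tt.
    have [d [d0 h]] := oX e Xe; have [e' [/h /XD + ce']] := generic_continuity n e hf d0.
    by [].
  move=> eps eps0; have [d [d0 h]] := contrapT (XD e Xe) eps eps0.
  by exists d; split => // e' _; exact: h.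
case: n dn pcs pX cX pX1 tX => [|n] dn pcs pX cX pX1 tX; first by case: tX => p [].
apply: Pieces_thin => //; [exact: pdec_Def pX|by move=> e Xe; apply/pX1; exists i|].
exact: pcs.
Qed.

(** * Cutting the fibers of finitely many definable sets in variable [0] *)

Section Stacking.
Context (L : finType) (A : L -> (nat -> R) -> Prop) (hA : forall l, Def (A l)).

Definition boundary (l : L) (X : nat -> R) : Prop := forall eps : R, 0 < eps ->
  (exists z : R, `|z - X 0%N| < eps /\ A l (scons z (tl X))) /\
  (exists z : R, `|z - X 0%N| < eps /\ ~ A l (scons z (tl X))).

Definition cuts (X : nat -> R) : Prop := -1 < X 0%N < 1 /\ exists l, boundary l X.

Lemma Def_cuts : Def cuts.
Proof.
rewrite /cuts; apply: Def_and; first def.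
by apply: Def_exists_fin => l; have := hA l; rewrite /boundary => hAl; def.
Qed.

(** Infinitely many cuts would fill an interval. A subinterval would consist of boundary points for
    one fixed [l], and a further one would lie inside [A l] or inside its complement, which is
    absurd. *)
Lemma cuts_small e : small_fiber cuts e.
Proof.
split; last by move=> y [].
have hZ := Def_cuts.
apply: contrapT => /(@infinite_interval _ (-1) 1) [].
- by rewrite /Def1 /=; def.
- by move=> y [/= /andP[a b] _]; rewrite in_itv /= !ltW.
move=> c [d [cd hcd]].
have [||l [c1 [d1 [cd1 cc1 dd1 h1]]]] :=
    interval_cover (S := fun l y => boundary l (scons y e)) _ cd.
- by move=> l; have hAl := hA l; rewrite /Def1 /boundary /=; def.
- by move=> y /hcd [].
have [||b [c2 [d2 [cd2 cc2 dd2 h2]]]] := interval_cover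
    (S := fun (b : bool) y => if b then A l (scons y e) else ~ A l (scons y e)) _ cd1.
- by move=> b; have hAl := hA l; rewrite /Def1; case: b; def.
- by move=> y _; have [Ay|nAy] := pselect (A l (scons y e)); [exists true|exists false].
have mid : c1 < (c2 + d2) / 2 < d1 by lra.
have eps0 : 0 < (d2 - c2) / 2 by lra.
have [[z [/= hz Az]] [z' [/= hz' nAz']]] := h1 _ mid _ eps0.
have z2 : c2 < z < d2 by move: hz; rewrite ltr_distl; lra.
have z2' : c2 < z' < d2 by move: hz'; rewrite ltr_distl; lra.
by case: b h2 => h2; [exact: nAz' (h2 z' z2')|exact: (h2 z z2) Az].
Qed.

(** Counting [1] as a cut guarantees a least one above any [a < 1]; the second alternative makes [1]
    absorbing. *)
Definition next_cut (e : nat -> R) (a v : R) : Prop :=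
  (a < 1 /\ ((cuts (scons v e) \/ v = 1) /\ a < v /\
     forall w : R, cuts (scons w e) \/ w = 1 -> a < w -> v <= w)) \/
  (1 <= a /\ v = 1).

(* [-1 = cut 0 e < cut 1 e < ...] enumerates the cuts over [e], and stays at [1]
   once they are exhausted. *)
Fixpoint cut (i : nat) (e : nat -> R) : R :=
  if i is i'.+1 then xget 0 [set v | next_cut e (cut i' e) v] else -1.

Lemma next_cut_unique e a v v' : next_cut e a v -> next_cut e a v' -> v = v'.
Proof.
move=> [[a1 [h1 [av h]]]|[a1 ->]] [[a1' [h1' [av' h']]]|[a1' ->]] //; try lra.
by apply/eqP; rewrite eq_le h // h'.
Qed.

Lemma Dfun_cut i : Dfun (cut i).
Proof.
have hZ := Def_cuts.
elim: i => [|i IH] /=; first by def_fun.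
apply: (Dfun_xget (Q := fun e v => next_cut e (cut i e) v)).
  apply: (Def_fun (Q := fun e a => next_cut (tl e) a (e 0%N)) (f := fun e => cut i (tl e))).
    by rewrite /next_cut; def.
  exact: Dfun_tl.
by move=> e; exact: next_cut_unique.
Qed.

Lemma cutP i e : next_cut e (cut i e) (cut i.+1 e).
Proof.
rewrite /=; case: xgetP => [v _ //|/= nn]; exfalso.
case: (leP 1 (cut i e)) => ai; first by apply: (nn 1); right.
have [||v [hv av] hmin] := @finite_min
    ([set w | cuts (scons w e) \/ w = 1] `&` [set w | cut i e < w]).
- apply: finite_setIl;
  apply: sub_finite_set (_ : finite_set ([set w | cuts (scons w e)] `|` [set 1])) => //.
  by rewrite finite_setU; split; [case: (cuts_small e)|exact: finite_set1].
- by exists 1; split=> //; right.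
apply: (nn v); left; split=> //; split => //; split => // w hw aw.
by apply: hmin.
Qed.

Lemma cut_le1 i e : cut i e <= 1.
Proof.
case: i => [|i]; first by rewrite /=; lra.
have [[_ [[[+ _]|->] _]]|[_ ->]] := cutP i e => //.
by move=> /= /andP[_ /ltW].
Qed.

Lemma cut_lt i e : cut i e < 1 -> cut i e < cut i.+1 e.
Proof. by move=> h; have [[_ [_ []]]|[]] := cutP i e => //; lra. Qed.

Lemma cut_mono i j e : (i <= j)%N -> cut i e <= cut j e.
Proof.
move=> /subnK <-; elim: (j - i)%N => [|k IH] //; apply: le_trans IH _.
rewrite addSn; case: (ltP (cut (k + i) e) 1) => h; first exact: ltW (cut_lt h).
by have [[h' _]|[_ ->]] := cutP (k + i) e; [lra|exact: cut_le1].
Qed.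

Lemma cut_ge i e : -1 <= cut i e.
Proof. exact: (@cut_mono 0 i e). Qed.

Lemma cut_cuts i e : cut i.+1 e < 1 -> cuts (scons (cut i.+1 e) e).
Proof.
move=> h; have h0 : cut i e < 1 by apply: le_lt_trans h; exact: cut_mono.
by have [[_ [[//|E] _]]|[]] := cutP i e; lra.
Qed.

Lemma no_cut_between i e y : cut i e < y < cut i.+1 e -> ~ cuts (scons y e).
Proof.
move=> /andP[iy yi] Zy.
have [[_ [_ [_ h]]]|[h1 h2]] := cutP i e; last by have := cut_le1 i.+1 e; lra.
by have := h y (or_introl Zy) iy; lra.
Qed.

(** If [cut N.+1 e] were below [1], the values of index [1] to [N.+1] would be [N.+1] distinct cuts
    over [e], more than the uniform bound. *)
Lemma cuts_exhausted : exists N, forall e, cut N.+1 e = 1.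
Proof.
have [N hN] := uniform_finiteness Def_cuts cuts_small.
exists N => e; apply/eqP; rewrite eq_le cut_le1 leNgt; apply/negP => lt1.
have lt i : (i <= N.+1)%N -> cut i e < 1.
  by move=> iN; apply: le_lt_trans lt1; exact: cut_mono.
have sz : ~ (size [seq cut i.+1 e | i <- iota 0 N.+1] <= N)%N.
  by rewrite size_map size_iota ltnn.
apply: sz; apply: (hN e).
  rewrite map_inj_in_uniq ?iota_uniq // => i j; rewrite !mem_iota !add0n !leq0n !andTb => iN jN E.
  case: (ltngtP i j) => // ij; exfalso.
    by have := cut_lt (lt i.+1 iN); rewrite E; have := cut_mono e (ij : i.+2 <= j.+1)%N; lra.
  by have := cut_lt (lt j.+1 jN); rewrite -E; have := cut_mono e (ij : j.+2 <= i.+1)%N; lra.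
move=> y /mapP[i]; rewrite mem_iota add0n => /andP[_ iN] ->.
by apply: cut_cuts; apply: lt.
Qed.

Lemma cut_location N e y : cut N.+1 e = 1 -> -1 < y < 1 ->
  exists i, (i <= N)%N /\ cut i e < 1 /\ (cut i e < y < cut i.+1 e \/ y = cut i.+1 e).
Proof.
move=> cN /andP[y0 y1].
have ex : exists i, y <= cut i e by exists N.+1; rewrite cN ltW.
case: (ex_minnP ex) => -[|i] yi imin; first by move: yi => /=; lra.
have iy : cut i e < y by rewrite ltNge; apply/negP => /imin; rewrite ltnn.
exists i; split; first by have := imin N.+1; rewrite cN ltW // => /(_ isT).
split; first by lra.
by move: yi; rewrite le_eqVlt => /orP[/eqP ->|yi]; [right|left; rewrite iy].
Qed.

Lemma cut_location_unique i j e y : cut i e < y <= cut i.+1 e ->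
  cut j e < y <= cut j.+1 e -> i = j.
Proof.
move=> /andP[a b] /andP[c d]; case: (ltngtP i j) => // ij; exfalso.
  by have := cut_mono e ij; lra.
by have := cut_mono e ij; lra.
Qed.

(** No boundary point lies between consecutive cuts, so membership is locally constant there and
    [loc_const] applies to it as a map to propositions. *)
Lemma membership_const i e y z l : cut i e < y < cut i.+1 e ->
  cut i e < z < cut i.+1 e -> A l (scons y e) -> A l (scons z e).
Proof.
move=> hy hz; have -> // : A l (scons y e) = A l (scons z e).
apply: (@loc_const _ (fun y => A l (scons y e)) (cut i e) (cut i.+1 e)) => // {y z hy hz} y hy.
have nb : ~ boundary l (scons y e).
  move=> b; apply: (no_cut_between hy); split; last by exists l.
  suff : -1 < y < 1 by [].
  by move: hy; have := cut_ge i e; have := cut_le1 i.+1 e; lra.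
move/existsNP: nb => [eps /not_implyP [eps0 /not_andP nb]]; exists eps => //= z zy.
have yy : `|y - y| < eps by rewrite subrr normr0.
apply/propext; case: nb => nb.
  split=> Az; [exfalso; apply: nb; exists z => //|exfalso; apply: nb; exists y => //].
by split=> _; apply: contrapT => nA; apply: nb; [exists y|exists z].
Qed.

End Stacking.
#[local] Arguments cut : simpl never.

Lemma Pieces_family n (F : nat -> (nat -> R) -> R) K :
  (forall f, Dfun f -> Pieces n f (box n)) -> (forall i, Dfun (F i)) ->
  exists (J : finType) (W : J -> (nat -> R) -> Prop),
    [/\ forall j, Def (W j), forall e, box n e -> exists j, W j e &
        forall j i, (i < K)%N -> cont n (W j) (F i)].
Proof.
move=> pcs hF; elim: K => [|K [J [W [hW cW kW]]]].
  by exists unit, (fun _ _ => True); split=> [_|e _|//]; [exact: Def_cst|exists tt].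
have [J' [W' [hW' cW' kW']]] := pcs (F K) (hF K).
exists (J * J')%type, (fun p e => W p.1 e /\ W' p.2 e); split=> [[j j']|e be|[j j'] i].
- exact: Def_and.
- have [j Wj] := cW e be; have [j' Wj'] := cW' e be; by exists (j, j').
- move=> iK e [/= We We'] eps eps0.
  have [d [d0 h]] : osc_lt n (if (i < K)%N then W j else W' j') (F i) e eps.
    case: ifP => iK'; first exact: kW.
    have -> : i = K by apply/eqP; rewrite eqn_leq -ltnS iK leqNgt iK'.
    exact: kW'.
  by exists d; split=> // e' [/= We1 We1']; apply: h; case: ifP.
Qed.

Lemma cont_sub n (C C' : (nat -> R) -> Prop) f :
  (forall e, C e -> C' e) -> cont n C' f -> cont n C f.
Proof.
move=> CC' h e Ce eps eps0; have [d [d0 hd]] := h e (CC' e Ce) eps eps0.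
by exists d; split=> // e' Ce'; apply: hd; exact: CC'.
Qed.

(** The base is decomposed compatibly with the sets [B s]: over each base cell it is then settled
    which cuts are below [1], the cuts are continuous, and every graph of a cut and every band
    between consecutive cuts is inside or outside each [A l]. *)
Lemma Decomp_S n : Decomp n -> (forall f, Dfun f -> Pieces n f (box n)) -> Decomp n.+1.
Proof.
move=> dn pcs L A hA.
have [N cutN] := cuts_exhausted hA.
have hcut := Dfun_cut hA.
have [J [W [hW covW contW]]] := Pieces_family N.+2 pcs hcut.
pose B (s : ('I_N.+2 + J) + ('I_N.+1 * L * bool)) e : Prop :=
  match s with
  | inl (inl i) => cut A i e < 1
  | inl (inr j) => W j e
  | inr (i, l, true) => exists y : R, cut A i e < y < cut A i.+1 e /\ A l (scons y e)
  | inr (i, l, false) => A l (scons (cut A i.+1 e) e)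
  end.
have hB s : Def (B s).
  case: s => [[i|j]|[[i l] [|]]]; rewrite /B //.
  - have := hcut i; set c := cut A i => hc; def.
  - have hc := hcut i; have hc' := hcut i.+1; have hAl := hA l.
    move: hc hc'; set c := cut A i; set c' := cut A i.+1 => hc hc'; def.
  - apply: (Def_fun (Q := fun e y => A l (scons y e))) => //.
    by have hAl := hA l; def.
have [I [X [pX cX]]] := dn _ B hB.
have [pX1 pX2] := pdec_part pX.
(* The sets [W j] cover the box, so a nonempty base cell meets one of them, and lies in it by
   compatibility. *)
have contX j i : (i < N.+2)%N -> cont n (X j) (cut A i).
  move=> iN; have [[e0 Xe0]|nX] := pselect (exists e, X j e); last first.
    by move=> e Xe; exfalso; apply: nX; exists e.
  have [|w Ww] := covW e0; first by apply/pX1; exists j.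
  apply: cont_sub (contW w i iN); have [//|h] := cX j (inl (inr w)).
  by exfalso; exact: h Xe0 Ww.
(* [(i, true)] is the band between the cuts [i] and [i.+1], [(i, false)] the graph of the cut
   [i.+1]. Requiring values below [1] discards the repetitions of [1] at the end of the
   enumeration. *)
pose Y (p : I * ('I_N.+1 * bool)) e := X p.1 (tl e) /\ cut A p.2.1 (tl e) < 1 /\
  if p.2.2 then is_true (cut A p.2.1 (tl e) < e 0%N < cut A p.2.1.+1 (tl e))
  else e 0%N = cut A p.2.1.+1 (tl e) /\ cut A p.2.1.+1 (tl e) < 1.
exists (I * ('I_N.+1 * bool))%type, Y; split; last first.
  move=> [j [i b]] l; case: b; last first.
    have E e : Y (j, (i, false)) e -> X j (tl e) /\ e = scons (cut A i.+1 (tl e)) (tl e).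
      by move=> [/= Xe [_ [<- _]]]; split=> //; rewrite scons_tl.
    have [h|h] := cX j (inr (i, l, false)); [left|right] => e /E[Xe ->];
      exact: h.
  have E e : Y (j, (i, true)) e -> X j (tl e) /\ cut A i (tl e) < e 0%N < cut A i.+1 (tl e).
    by move=> [/= Xe [_]].
  have [h|h] := cX j (inr (i, l, true)); [left|right] => e /E[Xe ei].
    have [y [yi Ay]] := h _ Xe; rewrite -(scons_tl e).
    by apply: membership_const yi ei Ay.
  by move=> Ae; apply: (h _ Xe); exists (e 0%N); split=> //; rewrite scons_tl.
have loc j i b e : Y (j, (i, b)) e -> cut A i (tl e) < e 0%N <= cut A i.+1 (tl e).
  by move=> [/= _ [i1]]; case: b => [/andP[-> /ltW]|[-> _]] //; rewrite lexx andbT; exact: cut_lt.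
split.
  split=> [e|[j [i b]] [j' [i' b']] e Ye Ye']; last first.
    have /= E : j = j' by apply: pX2 (proj1 Ye) (proj1 Ye').
    have Ei : i = i'.
      by apply: val_inj; exact: cut_location_unique (loc _ _ _ _ Ye) (loc _ _ _ _ Ye').
    move: Ye Ye'; rewrite -E -Ei => -[_ [_ /= h]] [_ [_ /= h']]; congr (_, (_, _)).
    clear E Ei; by case: b h; case: b' h' => //= h h'; exfalso; lra.
  split=> [be|[[j [i b]] Ye]].
    have /pX1[j Xj] : box n (tl e) by move=> i iN; exact: be.
    have [i [iN [i1 h]]] := cut_location (cutN (tl e)) (be 0%N isT).
    have iN' : (i < N.+1)%N by [].
    case: h => h.
      by exists (j, (Ordinal iN', true)).
    exists (j, (Ordinal iN', false)); split => //; split => //=; split=> //.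
    by rewrite -h; case/andP: (be 0%N isT).
  have bt : box n (tl e) by apply/pX1; exists j; case: Ye.
  move=> [_|k kN]; last exact: bt.
  have := loc _ _ _ _ Ye; have := cut_ge hA i (tl e).
  by case: b Ye => -[_ [/= _]] => [/andP[h1 h2]|[h1 h2]]; have := cut_le1 hA i.+1 (tl e); lra.
exists I, X; split=> //.
  move=> [j [i b]].
  (* If a required cut has already reached [1] over the base cell, the member is empty. *)
  have emp (s : 'I_N.+2) : (forall e, X j e -> ~ B (inl (inl s)) e) ->
      (forall e, Y (j, (i, b)) e -> cut A s (tl e) < 1) -> forall e, ~ Y (j, (i, b)) e.
    by move=> h h' e Ye; apply: (h (tl e)); [case: Ye|exact: h'].
  have iN : (i < N.+2)%N by apply: leq_trans (ltn_ord i) _.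
  have [h1|h1] := cX j (inl (inl (Ordinal iN))); last first.
    by left; apply: emp h1 _ => e [_ []].
  case: b emp => emp.
    right; exists j; right; exists (cut A i), (cut A i.+1).
    split; [by split=> //; apply: contX| |by move=> e /h1; apply: cut_lt|].
      by split=> //; apply: contX; rewrite ltnS.
    apply: funext => e; apply/propext; rewrite /Y /bandE /=; split=> [[? []]|[? ?]] //.
    by split=> //; split=> //; exact: h1.
  have iN' : (i.+1 < N.+2)%N by rewrite ltnS.
  have [h2|h2] := cX j (inl (inl (Ordinal iN'))); last first.
    by left; apply: emp h2 _ => e [_ [_ []]].
  right; exists j; left; exists (cut A i.+1); split=> //; first exact: contX.
  apply: funext => e; apply/propext; rewrite /Y /graphE; split=> [[? [_ []]]|[? ?]] //.
  by split=> //; split; [exact: h1|split=> //; exact: h2].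
(* The lowest band, starting at [-1], exists over every base cell, so no base cell is lost under
   projection. *)
move=> j; exists (j, (ord0, true)); right; exists (cut A 0), (cut A 1).
have l1 e : cut A 0 e < 1 by have -> : cut A 0 e = -1 by []; lra.
split; [by split=> //; apply: contX|by split=> //; apply: contX|by move=> e _; apply: cut_lt|].
by apply: funext => e; apply/propext; rewrite /Y /bandE; split=> [[? []]|[? ?]].
Qed.

(** Without variables the box is the whole parameter space, and the members are the atoms of the
    Boolean algebra generated by the [A l]. *)
Lemma Decomp_0 : Decomp 0.
Proof.
move=> L A hA.
pose X (p : {set L}) e := forall l, l \in p <-> A l e.
exists {set L}, X; split; last first.
  move=> p l; case: (boolP (l \in p)) => lp; [left|right] => e Xe; first exact/Xe.
  by move=> /Xe; apply/negP.
split; last by move=> p; apply: Def_forall_fin => l; apply: Def_iff => //; exact: Def_cst.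
split=> [e|p q e hp hq].
  split=> // _; exists [set l | `[< A l e >]]%SET => l; rewrite inE.
  by split=> /asboolP.
by apply/setP => l; apply/idP/idP => [/hp/hq|/hq/hp].
Qed.

(** Simultaneous induction: decomposing in [n.+1] variables uses continuity pieces in [n], and
    pieces in [n.+1] use that decomposition together with pieces in [n]. *)
Lemma Decomp_Pieces n : Decomp n /\ forall f, Dfun f -> Pieces n f (box n).
Proof.
elim: n => [|n [dn pn]].
  by split=> [|f hf]; [exact: Decomp_0|apply: Pieces_of_Decomp => //; exact: Decomp_0].
have dS := Decomp_S dn pn; split=> // f hf.
by apply: Pieces_of_Decomp => // _ [<-].
Qed.

(** * Cells in spaces of row vectors *)

(* The bits of [s] tell, from the last variable to the first one, which
   coordinates vary freely (bands) and which are functions of the previous ones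
   (graphs). *)
Fixpoint pcell (s : seq bool) (X : (nat -> R) -> Prop) : Prop :=
  match s with
  | [::] => Def X
  | b :: s' => exists2 C, pcell s' C &
      if b then
        exists f g, [/\ Dfun f /\ cont (size s') C f, Dfun g /\ cont (size s') C g,
          forall e, C e -> f e < g e & X = bandE C f g]
      else exists f, [/\ Dfun f, cont (size s') C f & X = graphE C f]
  end.

Lemma stacked_pcell s C X : pcell s C -> stacked (size s) C X -> exists b, pcell (b :: s) X.
Proof.
by move=> pC [[f [hf cf ->]]|[f [g h]]]; [exists false|exists true]; exists C => //;
  [exists f|exists f, g].
Qed.

Lemma pdec_pcell n (I : finType) (X : I -> (nat -> R) -> Prop) i : pdec n X ->
  (forall e, ~ X i e) \/ exists2 s, size s = n & pcell s (X i).
Proof.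
elim: n I X i => [|n IH] I X i [] /= _; first by move=> h; right; exists [::] => //=.
move=> [I' [X' [h1 h2 _]]].
have [h|[i' h]] := h2 i; [by left|].
have [emp|[s sn ps]] := IH _ _ i' h1.
  by left=> e; case: h => [[f [_ _ ->]]|[f [g [_ _ _ ->]]]] [/emp].
right; rewrite -sn in h; have [b pb] := stacked_pcell ps h.
by exists (b :: s) => //=; rewrite sn.
Qed.

Lemma pcell_Def s X : pcell s X -> Def X.
Proof.
elim: s X => [|b s IH] X //= [C /IH hC]; case: b => [[f [g [[hf _] [hg _] _ ->]]]|[f [hf _ ->]]].
  by rewrite /bandE; def.
by rewrite /graphE; def.
Qed.

(** With parameters fixed, the free coordinates determine the others continuously, because graphs
    are graphs of continuous functions. This yields both the injectivity of the projection and the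
    continuity of its inverse. *)
Lemma pcell_rigid s X : pcell s X -> forall e (eps : R), X e -> 0 < eps ->
  exists d : R, 0 < d /\ forall e', X e' -> (forall i, (size s <= i)%N -> e' i = e i) ->
    (forall i, nth false s i -> `|e' i - e i| < d) ->
    forall i, (i < size s)%N -> `|e' i - e i| < eps.
Proof.
elim: s X => [|b s IH] X /=; first by move=> _ e eps _ _; exists 1.
move=> [C /IH h]; case: b => [[f [g [_ _ _ ->]]]|[f [_ cf ->]]] e eps [Ce e0] eps0.
  have [d [d0 hd]] := h _ _ Ce eps0.
  exists (Num.min eps d); split; first by rewrite lt_min eps0.
  move=> e' [Ce' _] h1 h2 [_|i iN].
    by have := h2 0%N isT; rewrite lt_min => /andP[].
  apply: (hd (tl e')) => // [j jN|j js]; first exact: h1.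
  by have := h2 j.+1 js; rewrite lt_min => /andP[].
have [d1 [d10 h1]] := cf _ Ce _ eps0.
have m0 : 0 < Num.min eps d1 by rewrite lt_min eps0.
have [d [d0 hd]] := h _ _ Ce m0.
exists d; split=> // e' [Ce' e0'] he hs.
have key i : (i < size s)%N -> `|tl e' i - tl e i| < Num.min eps d1.
  by apply: (hd (tl e')) => // [j jN|j js]; [exact: he|exact: (hs j.+1)].
move=> [_|i iN]; last by have := key i iN; rewrite lt_min => /andP[].
rewrite e0 e0'; apply: h1 => //; split=> i iN; last exact: he.
by have := key i iN; rewrite lt_min => /andP[].
Qed.

Definition cellset n X (c : nat -> R) : set 'rV[R]_n := [set x | X (code x c)].
Arguments cellset : clear implicits.

Definition rowS n (y : 'rV[R]_n) (a : R) : 'rV[R]_n.+1 :=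
  \row_j if unlift ord_max j is Some k then y 0 k else a.

Lemma front_rowS n (y : 'rV[R]_n) a : Defs.front (rowS y a) = y.
Proof. by apply/rowP => j; rewrite !mxE liftK. Qed.

Lemma last_rowS n (y : 'rV[R]_n) a : rowS y a 0 ord_max = a.
Proof. by rewrite mxE unlift_none. Qed.

Lemma coord_ord n (x : 'rV[R]_n) (j : 'I_n) : coord x j = x 0 j.
Proof. by rewrite /coord insubT // => lt; congr (x _ _); apply: val_inj. Qed.

Lemma code_S n (x : 'rV[R]_n.+1) c :
  code x c = scons (x 0 ord_max) (code (Defs.front x) c).
Proof.
apply: funext => -[|i]; rewrite /code /=; first by rewrite subSS subn0 -(coord_ord x ord_max).
rewrite ltnS !subSS; case: ltnP => // iN.
have lt : (n - i.+1 < n)%N by rewrite ltn_subrL (leq_ltn_trans _ iN).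
rewrite (coord_ord (Defs.front x) (Ordinal lt)) mxE -coord_ord; congr (coord x _).
by rewrite /= /bump leqNgt lt.
Qed.

Lemma code_0 (x : 'rV[R]_0) c : code x c = c.
Proof. by apply: funext => i; rewrite /code subn0. Qed.

Lemma code_coord n (x : 'rV[R]_n) c (j : 'I_n) : code x c (n - j.+1) = x 0 j.
Proof.
rewrite /code ltn_subrL (leq_ltn_trans _ (ltn_ord j)) //= -coord_ord; congr coord.
by rewrite subnSK // subKn // ltnW.
Qed.

Lemma code_ge n (x : 'rV[R]_n) c i : (n <= i)%N -> code x c i = c (i - n)%N.
Proof. by move=> ni; rewrite /code ltnNge ni. Qed.

Lemma ord_code n i : (i < n)%N -> exists j : 'I_n, i = (n - j.+1)%N.
Proof.
move=> iN; have lt : (n - i.+1 < n)%N by rewrite ltn_subrL (leq_ltn_trans _ iN).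
by exists (Ordinal lt); rewrite /= subnSK // subKn // ltnW.
Qed.

Lemma near_code n (x y : 'rV[R]_n) c d : (forall j, `|y 0 j - x 0 j| < d) ->
  near n (code x c) d (code y c).
Proof.
move=> h; split=> i iN; last by rewrite !code_ge.
by have [j ->] := ord_code iN; rewrite !code_coord.
Qed.

Lemma within_contP n (C : set 'rV[R]_n) (f : 'rV[R]_n -> R) :
  (forall x (eps : R), C x -> 0 < eps -> exists d : R, 0 < d /\ forall y, C y ->
    (forall j, `|y 0 j - x 0 j| < d) -> `|f y - f x| < eps) ->
  {within C, continuous f}.
Proof.
move=> h; apply/subspace_continuousP => x Cx; apply/cvgrPdist_lt => eps eps0.
have [d [d0 hd]] := h x eps Cx eps0.
rewrite near_withinE; apply/nbhs_ballP; exists d => //= y [_ xy] Cy.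
rewrite distrC; apply: hd => // j; rewrite distrC; exact: xy.
Qed.

Lemma within_cont_rowP n p (C : set 'rV[R]_n) (f : 'rV[R]_n -> 'rV[R]_p) :
  (forall x (eps : R), C x -> 0 < eps -> exists d : R, 0 < d /\ forall y, C y ->
    (forall j, `|y 0 j - x 0 j| < d) -> forall k, `|f y 0 k - f x 0 k| < eps) ->
  {within C, continuous f}.
Proof.
move=> h; apply/subspace_continuousP => x Cx; apply/cvg_ballP => eps eps0.
have [d [d0 hd]] := h x eps Cx eps0.
rewrite near_withinE; apply/nbhs_ballP; exists d => //= y [_ xy] Cy.
split=> // i k; rewrite /ball /= distrC (ord1 i); apply: hd => // j.
by rewrite distrC; exact: xy.
Qed.

Lemma cont_within n C f c : cont n C f ->
  {within cellset n C c, continuous (fun x => f (code x c))}.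
Proof.
move=> cf; apply: within_contP => x eps Cx eps0.
have [d [d0 hd]] := cf _ Cx eps eps0.
by exists d; split=> // y Cy h; apply: hd => //; exact: near_code.
Qed.

Lemma cellset_graph n C f c : cellset n.+1 (graphE C f) c =
  Defs.graph (cellset n C c) (fun x => f (code x c)).
Proof. by apply: eq_set => x; rewrite /graphE code_S. Qed.

Lemma cellset_band n C f g c : cellset n.+1 (bandE C f g) c =
  Defs.band (cellset n C c) (fun x => (f (code x c))%:E) (fun x => (g (code x c))%:E).
Proof. by apply: eq_set => x; rewrite /bandE code_S /= !lte_fin. Qed.

Lemma cellset_definable_continuous n C f c : Def C -> Dfun f -> cont n C f ->
  definable_continuous M (cellset n C c) (fun x => f (code x c)).
Proof.
move=> hC hf cf; split; last exact: cont_within.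
by rewrite -cellset_graph; apply: Def_definable; rewrite /graphE; def.
Qed.

(** Induction on [s]. Cells start in dimension 1, so the lowest level is treated apart: nonemptiness
    makes its base the one-point space [R^0], and its graph or band a point or an interval. *)
Lemma cellset_cell s b X c : pcell (b :: s) X -> cellset (size s).+1 X c !=set0 ->
  cell M (count id (b :: s)) (cellset (size s).+1 X c).
Proof.
elim: s b X => [|b' s IH] b X.
  move=> [C _]; case: b => [[f [g [_ _ fg ->]]]|[f [_ _ ->]]] [x].
    rewrite cellset_band => -[/= + _]; rewrite /cellset /= code_0 => Cc.
    have -> : Defs.band (cellset 0 C c) (fun x => (f (code x c))%:E)
        (fun x => (g (code x c))%:E) = [set x | [set y | (f c)%:E < y%:E < (g c)%:E]%E (x 0 0)].
      apply: eq_set => y; rewrite /cellset /= !code_0 (ord1 ord_max).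
      by apply/propext; split=> [[]|].
    by apply: cell_interval; exists (f c)%:E, (g c)%:E; rewrite lte_fin fg.
  rewrite cellset_graph => -[/= + _]; rewrite /cellset /= code_0 => Cc.
  have -> : Defs.graph (cellset 0 C c) (fun x => f (code x c)) =
      [set x | x 0 0 = f c].
    apply: eq_set => y; rewrite /cellset /= !code_0 (ord1 ord_max).
    by apply/propext; split=> [[]|].
  exact: cell_point.
move=> [C pC' h]; have pC : pcell (b' :: s) C := pC'.
have hC := pcell_Def pC; have dc := cellset_definable_continuous c hC.
case: b h => [[f [g [[hf cf] [hg cg] fg ->]]]|[f [hf cf ->]]] [x].
  rewrite cellset_band => -[/= Cx _].
  apply: cell_band; first by apply: IH pC _; exists (Defs.front x).
  - by constructor 3; exists (fun x => f (code x c)) => //; exact: dc.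
  - by constructor 3; exists (fun x => g (code x c)) => //; exact: dc.
  - by move=> y Cy; rewrite lte_fin; exact: fg.
rewrite cellset_graph => -[/= Cx _].
apply: cell_graph; last exact: dc.
by apply: IH pC _; exists (Defs.front x).
Qed.

(** * Types of cells *)

Definition free_coords n (s : seq bool) : seq 'I_n :=
  [seq j : 'I_n <- enum 'I_n | nth false s (n - j.+1)].

Lemma size_free_coords s : size (free_coords (size s) s) = count id s.
Proof.
rewrite size_filter -(count_map (fun j : 'I_(size s) => nth false s (size s - j.+1)) id).
rewrite -(count_rev id s); congr count.
apply: (@eq_from_nth _ false); rewrite size_map size_enum_ord ?size_rev // => i iN.
by rewrite (nth_map (Ordinal iN)) ?size_enum_ord // nth_enum_ord // nth_rev.
Qed.

Lemma sorted_free_coords n s : sorted (fun i j : 'I_n => (i < j)%N) (free_coords n s).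
Proof.
apply: sorted_filter; first by move=> i j k; exact: ltn_trans.
by have := iota_ltn_sorted 0 n; rewrite -val_enum_ord sorted_map.
Qed.

Lemma cellset_proj_rigid s X c (J := in_tuple (free_coords (size s) s)) x (eps : R) :
  pcell s X -> cellset (size s) X c x -> 0 < eps ->
  exists d : R, 0 < d /\ forall y, cellset (size s) X c y ->
    (forall k, `|coord_proj J y 0 k - coord_proj J x 0 k| < d) ->
    forall j, `|y 0 j - x 0 j| < eps.
Proof.
move=> pX Xx eps0; have [d [d0 hd]] := pcell_rigid pX Xx eps0.
exists d; split=> // y Xy h j; rewrite -(code_coord y c) -(code_coord x c).
apply: hd => // [i iN|i si|]; first by rewrite !code_ge.
  have iN : (i < size s)%N by rewrite ltnNge; apply/negP => h'; rewrite nth_default in si.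
  have [k ik] := ord_code iN; rewrite ik !code_coord.
  have kJ : k \in J by rewrite mem_filter mem_enum -ik si.
  have /tnthP [q ->] := kJ.
  by have := h q; rewrite !mxE.
by rewrite ltn_subrL (leq_ltn_trans _ (ltn_ord j)).
Qed.

Lemma cellset_homeo s X c (J := in_tuple (free_coords (size s) s)) : pcell s X ->
  definable_homeo M (cellset (size s) X c) (coord_proj J).
Proof.
move=> pX; set n := size s; set d := size (free_coords n s).
have hX := pcell_Def pX.
(* Reads the code of [x], followed by the parameters [c], off the code of the row [(x, y)] of length
   [n + d]. *)
pose t i e : R := if (i < n)%N then e (n + d - (n - i.+1).+1)%N else c (i - n)%N.
have st i : simple (t i).
  by rewrite /t; case: (i < n)%N; [left|right]; eexists; reflexivity.
pose P e := X (t^~ e) /\ forall k : 'I_d,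
  e (n + d - (n + k).+1)%N = e (n + d - (tnth J k).+1)%N.
have hP : Def P.
  apply: Def_and; first exact: Def_subst.
  by apply: Def_forall_fin => k; exact: Def_var_eq.
have inj x y : cellset n X c x -> cellset n X c y -> coord_proj J x = coord_proj J y -> x = y.
  (* If the coordinates [j] differed, rigidity with [eps] equal to their distance would make this
     distance smaller than itself. *)
  move=> Xx Xy E; apply/rowP => j; apply/eqP; rewrite eq_sym -subr_eq0 -normr_eq0.
  rewrite -[_ == 0]negbK normr_eq0 -normr_gt0; apply/negP => eps0.
  have [r [r0 hr]] := cellset_proj_rigid pX Xx eps0.
  have := hr y Xy _ j; rewrite ltxx E => /(_ _) H; apply: notF; apply: H => k.
  by rewrite subrr normr0.
split.
- have -> : [set row_mx x (coord_proj J x) | x in cellset n X c] =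
      [set z : 'rV_(n + d) | P (code z (fun=> 0))].
    have tE (x : 'rV[R]_n) (y : 'rV[R]_d) : t^~ (code (row_mx x y) (fun=> 0)) = code x c.
      apply: funext => i; rewrite /t; case: ltnP => iN; last by rewrite code_ge.
      have [j ij] := ord_code iN; rewrite [in RHS]ij code_coord.
      have -> : (n - i.+1)%N = j by rewrite ij subnSK // subKn // ltnW.
      by rewrite -[val j]/(val (lshift d j)) code_coord row_mxEl.
    apply/seteqP; split=> [_ [x Xx <-]|z].
      split=> /=; first by rewrite tE.
      move=> k; rewrite -[(n + k)%N]/(val (rshift n k)) code_coord row_mxEr mxE.
      by rewrite -[val (tnth J k)]/(val (lshift d (tnth J k))) code_coord row_mxEl.
    rewrite -(hsubmxK z); move: (lsubmx z) (rsubmx z) => x y [/=]; rewrite tE => Xx h.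
    exists x => //; congr row_mx; apply/rowP => k; rewrite mxE.
    have := h k; rewrite -[(n + k)%N]/(val (rshift n k)) code_coord row_mxEr.
    by rewrite -[val (tnth J k)]/(val (lshift d (tnth J k))) code_coord row_mxEl.
  exact: Def_definable.
- apply: within_cont_rowP => x eps _ eps0; exists eps; split=> // y _ h k.
  by rewrite !mxE.
- pose g (y : 'rV[R]_d) := xget 0 [set x | cellset n X c x /\ coord_proj J x = y].
  have gK x : cellset n X c x -> g (coord_proj J x) = x.
    move=> Xx; rewrite /g; case: xgetP => [y _ [Xy /inj ->] //|/(_ x)].
    by move=> /(_ (conj Xx erefl)).
  exists g => //; apply: within_cont_rowP => _ eps [x Xx <-] eps0.
  have [r [r0 hr]] := cellset_proj_rigid pX Xx eps0.
  exists r; split=> // _ [y Xy <-] h k; rewrite !gK //.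
  exact: hr.
Qed.

Lemma cellset_of_type n s X c : size s = n.+1 -> pcell s X ->
  cellset n.+1 X c !=set0 ->
  of_type M (cellset n.+1 X c) (in_tuple (free_coords n.+1 s)).
Proof.
case: s => // b s [<-] pX nX; split; last exact: (@cellset_homeo (b :: s) X c).
  by rewrite (size_free_coords (b :: s)); exact: cellset_cell.
exact: sorted_free_coords.
Qed.

Lemma code_rowS n (y : 'rV[R]_n) a c : code (rowS y a) c = scons a (code y c).
Proof. by rewrite code_S front_rowS last_rowS. Qed.

Lemma front_cellset_box n c :
  @Defs.front R n @` cellset n.+1 (box n.+1) c = cellset n (box n) c.
Proof.
apply/seteqP; split=> [_ [x bx <-]|y yb].
  by move=> i iN; have := bx i.+1 iN; rewrite code_S.
exists (rowS y 0); last exact: front_rowS.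
rewrite /cellset /= code_rowS => -[_|i iN] /=; [lra|exact: yb].
Qed.

Lemma front_cellset_stacked n C X c : stacked n C X ->
  @Defs.front R n @` cellset n.+1 X c = cellset n C c.
Proof.
move=> h; apply/seteqP; split=> [_ [x Xx <-]|y Cy].
  move: Xx; rewrite /cellset /= code_S.
  by case: h => [[f [_ _ ->]]|[f [g [_ _ _ ->]]]] [].
case: h => [[f [_ _ ->]]|[f [g [_ _ fg ->]]]].
  by exists (rowS y (f (code y c))); [rewrite /cellset /= code_rowS|exact: front_rowS].
have := fg _ Cy => fgy.
exists (rowS y ((f (code y c) + g (code y c)) / 2)); last exact: front_rowS.
by rewrite /cellset /= code_rowS; split => //; rewrite tl_scons /=; lra.
Qed.

Definition cells n (I : Type) (X : I -> (nat -> R) -> Prop) c : set (set 'rV[R]_n) :=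
  [set D | D !=set0 /\ exists i, D = cellset n (X i) c].
Arguments cells n [I] X c.

Lemma cells_partition n (I : finType) (X : I -> (nat -> R) -> Prop) c :
  pdec n.+1 X -> cell_partition M (cellset n.+1 (box n.+1) c) (cells n.+1 X c).
Proof.
move=> pX; have [pX1 pX2] := pdec_part pX; split.
- apply: sub_finite_set
    (finite_image (fun i => cellset n.+1 (X i) c) (@finite_finset _ [set: I])).
  by move=> D [_ [i ->]]; exists i.
- split=> [|D D' [_ [i ->]] [_ [j ->]] [x [/= xi xj]]|D [] //].
    apply/seteqP; split=> [x [D [_ [i ->]] Xi]|x bx].
      by apply/pX1; exists i.
    have /pX1[i Xi] := bx; exists (cellset n.+1 (X i) c) => //.
    by split; [exists x|exists i].
  by rewrite (pX2 _ _ _ xi xj).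
- move=> D [D0 [i Di]]; have [emp|[s sn ps]] := pdec_pcell i pX.
    by case: D0 => x; rewrite Di => /emp.
  exists (count id s); move: D0; rewrite Di.
  by case: s sn ps => // b s [<-]; exact: cellset_cell.
Qed.

Lemma cells_decomposition n (I : finType) (X : I -> (nat -> R) -> Prop) c :
  pdec n.+1 X -> cell_decomposition M (cellset n.+1 (box n.+1) c) (cells n.+1 X c).
Proof.
elim: n I X => [|n IH] I X pX.
  by apply: cell_decomposition1; exact: cells_partition.
apply: cell_decompositionS; first exact: cells_partition.
have [_ [I' [X' [pX' h1 h2]]]] := pX.
rewrite front_cellset_box.
have -> : [set @Defs.front R n.+1 @` D | D in cells n.+2 X c] = cells n.+1 X' c.
  apply/seteqP; split=> [_ [D [[x Dx] [i Di]] <-]|D [[y Dy] [i' Di']]].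
    have [emp|[i' si]] := h1 i; first by move: Dx; rewrite Di => /emp.
    split; first by exists (Defs.front x), x.
    by exists i'; rewrite Di; exact: front_cellset_stacked.
  (* Every base member carries some stacked member, so every base cell is a projection. *)
  have [i si] := h2 i'; have E := front_cellset_stacked c si.
  move: Dy; rewrite Di' -E => -[x Xx _].
  exists (cellset n.+2 (X i) c) => //; split; [by exists x|by exists i].
exact: IH.
Qed.

(** The fiber over [b] of a coded set is thus a [cellset] whose parameters are the code of [b]. *)
Lemma code_row_mx m n (b : 'rV[R]_m) (x : 'rV[R]_n) c :
  code (row_mx b x) c = code x (code b c).
Proof.
apply: funext => i; case: (ltnP i (m + n)) => [iN|iN]; last first.
  rewrite !code_ge //; last exact: leq_trans (leq_addl _ _) iN.
    by rewrite addnC subnDA.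
  by rewrite leq_subRL ?(leq_trans (leq_addl _ _) iN) // addnC.
have [j ->] := ord_code iN; rewrite code_coord mxE; case: splitP => k jk.
  rewrite jk code_ge; last by rewrite -addnBAC ?leq_addl // ltn_ord.
  have -> : (m + n - k.+1 - n = m - k.+1)%N by rewrite subnAC addnK.
  by rewrite code_coord.
by rewrite jk -addnS subnDl code_coord.
Qed.

Lemma row_code N (z : 'rV[R]_N) c : \row_j code z c (N - j.+1)%N = z.
Proof. by apply/rowP => j; rewrite mxE code_coord. Qed.

End Definability.
Arguments cellset {R} n X c.
Arguments cells {R} n [I] X c.

(** * Transfer of the decomposition from environments to subsets of [R^(m+n)] *)

Theorem theorem4p5 (R : realType) (M : expansion R)
  (hM : locally_o_minimal M) (m n : nat) (hn : (0 < n)%N)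
  (Lambda : finType) (A : Lambda -> set 'rV[R]_(m + n))
  (hA : forall l, definable M (A l)) :
  exists (B : set 'rV[R]_n) (k : nat) (X : 'I_k -> set 'rV[R]_(m + n)),
    open_box B /\ B 0 /\
    partition setT X [set z | B (rsubmx z)] /\
    (forall i, definable M (X i)) /\
    (forall b : 'rV[R]_m, cell_decomposition M B
       [set C | C !=set0 /\ exists i, C = fiber (X i) b]) /\
    (forall i l, X i `&` A l = set0 \/ X i `<=` A l) /\
    (forall i, exists (d : nat) (J : d.-tuple 'I_n),
       forall b : 'rV[R]_m, fiber (X i) b !=set0 ->
         of_type M (fiber (X i) b) J).
Proof.
case: n hn A hA => // n _ A hA.
have hA' l := definable_Def (hA l).
have [I [X [pX cX]]] := (Decomp_Pieces hM n.+1).1 _ _ hA'.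
have [pX1 pX2] := pdec_part pX.
pose z0 : nat -> R := fun=> 0.
(* A partition has no empty member, so only the indices of nonempty sets are kept and enumerated. *)
pose P := [set i : I | `[< exists z : 'rV[R]_(m + n.+1), X i (code z z0) >]]%SET.
pose Y (i : 'I_#|P|) : set 'rV[R]_(m + n.+1) := [set z | X (enum_val i) (code z z0)].
have fibE (i : 'I_#|P|) b : fiber (Y i) b = cellset n.+1 (X (enum_val i)) (code b z0).
  by apply: eq_set => x; rewrite /fiber /Y /= code_row_mx.
have inP i (z : 'rV[R]_(m + n.+1)) : X i (code z z0) -> exists k : 'I_#|P|, enum_val k = i.
  move=> Xz; have iP : i \in P by rewrite inE; apply/asboolP; exists z.
  by exists (enum_rank_in iP i); rewrite enum_rankK_in.
pose B : set 'rV[R]_n.+1 := [set y | forall i, -1 < y 0 i < 1].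
have boxE (y : 'rV[R]_n.+1) c : box n.+1 (code y c) <-> B y.
  split=> [h i|h i iN]; first by rewrite -(code_coord y c); apply: h; rewrite subSS ltnS leq_subr.
  by have [j ->] := ord_code iN; rewrite code_coord.
have BE c : B = cellset n.+1 (box n.+1) c.
  by apply: eq_set => y; apply/propext; split=> /boxE.
have codeE (z : 'rV[R]_(m + n.+1)) : code z z0 = code (rsubmx z) (code (lsubmx z) z0).
  by rewrite -code_row_mx hsubmxK.
exists B, #|P|, Y; split.
  exists (fun=> [set y : R | -1 < y < 1]); split=> // _.
  exists (-1)%:E, 1%:E; rewrite lte_fin; split; first lra.
  by apply: eq_set => y; rewrite !lte_fin.
split; first by move=> i; rewrite mxE; lra.
split.
  split.
  - apply/seteqP; split=> [z [i _ /= Xz]|z /= Bz].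
      by apply/(boxE _ (code (lsubmx z) z0)); rewrite -codeE; apply/pX1; exists (enum_val i).
    have /pX1[i Xz] : box n.+1 (code z z0) by rewrite codeE; apply/boxE.
    have [k ki] := inP _ _ Xz; exists k => //=; by rewrite /Y /= ki.
  - move=> i j _ _ [z [/= Xi Xj]]; apply: enum_val_inj; exact: pX2 Xi Xj.
  - move=> i _; have := enum_valP i; rewrite inE => /asboolP[z Xz]; by exists z.
split; first by move=> i; apply: Def_definable; exact: pdec_Def pX.
split.
  move=> b; rewrite (BE (code b z0)).
  have -> : [set C | C !=set0 /\ exists i, C = fiber (Y i) b] = cells n.+1 X (code b z0).
    apply: eq_set => C; apply/propext; split=> -[[x Cx] [i Ci]]; split; try by exists x.
      by exists (enum_val i); rewrite Ci fibE.
    move: Cx; rewrite Ci /cellset /= -code_row_mx => /inP[k <-].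
    by exists k; rewrite fibE.
  exact: cells_decomposition.
split.
  move=> i l; have [h|h] := cX (enum_val i) l; [right|left].
    by move=> z /h; rewrite row_code.
  by apply/seteqP; split=> // z [/h]; rewrite row_code.
(* The bits [s] depend on [i] and not on [b], whence one type for all nonempty fibers. *)
move=> i; have [emp|[s sn ps]] := pdec_pcell (enum_val i) pX.
  by exists 0%N, [tuple] => b [x]; rewrite fibE => /emp.
exists (size (free_coords n.+1 s)), (in_tuple (free_coords n.+1 s)) => b.
by rewrite fibE; exact: cellset_of_type.
Qed.
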